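(* Let $\xi>0$, $\mathsf{p}>12$ and $\mathsf{K}>0$. Let $w=\{w_{ij}\}_{i,j\ge 1}$ be independent real random variables on a probability space $(\Omega_w,\mathcal{F}_w,\mathbb{P}_w)$ with $\mathbb{E}_w w_{ij}=0$, $\mathbb{E}_w w_{ij}^2=1$ and $\mathbb{E}_w|w_{ij}|^{\mathsf{p}}\le \mathsf{K}$ for all $i,j$. For each $N$ put $M=\lfloor \xi N\rfloor$ and let $\sigma=\sigma_N$ be chosen uniformly at random, with law $\mathbb{P}_\sigma$ and independently of $w$, from all up-right paths from $(1,1)$ to $(M,N)$ in the rectangle $\square_{M,N}$. Then for $\mathbb{P}_w$-almost every environment $w$, $$\frac{1}{\sqrt{M+N-1}}\sum_{(i,j)\in \sigma}w_{ij}\ \xrightarrow{\ \mathscr{D}\ }\ \mathscr{N}(0,1),\qquad N\to\infty,$$ where, with $w$ held fixed, the convergence in distribution to the standard normal is with respect to $\mathbb{P}_\sigma$.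
   Context: $\square_{M,N}=\{(i,j)\in\mathbb{Z}^2: 1\le i\le M,\ 1\le j\le N\}$. An up-right path from $(1,1)$ to $(M,N)$ is a collection $\{(i_k,j_k): k=1,\ldots,M+N-1\}$ with $(i_1,j_1)=(1,1)$, $(i_{M+N-1},j_{M+N-1})=(M,N)$, and $(i_{k+1}-i_k,j_{k+1}-j_k)\in\{(1,0),(0,1)\}$ for each $k$. The weights $w_{ij}$ are independent but not necessarily identically distributed; the same environment $w$ on $\mathbb{Z}_{\ge1}^2$ is used for all $N$. Only $N$ with $M\ge 1$ are considered (all large $N$). *)

(* Defs.v *)
From HB Require Import structures.
From mathcomp Require Import all_boot all_order all_algebra.
From mathcomp Require Import finmap.
From mathcomp Require Import all_classical all_reals all_analysis.
From mathcomp Require Import zify.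

Set Implicit Arguments.
Unset Strict Implicit.
Unset Printing Implicit Defensive.

Import Order.TTheory GRing.Theory Num.Def Num.Theory.
Import numFieldNormedType.Exports.

Local Open Scope classical_set_scope.
Local Open Scope ring_scope.

Definition mutually_independent d (T : measurableType d) (R : realType)
    (P : probability T R) (I : choiceType) (A : set I)
    (X : I -> {RV P >-> R}) : Prop :=
  forall (J : {fset I}) (B : I -> set R),
    [set` J] `<=` A -> (forall i, measurable (B i)) ->
    P (\bigcap_(i in [set` J]) X i @^-1` B i) =
    (\prod_(i <- J) P (X i @^-1` B i))%E.

(* R and measurableTypeR R carry the same Borel sets under two different
   displays: laws of {RV P >-> R} use the former, normal_prob the latter. *)
Definition weak_cvg (R : realType) (mu : nat -> probability R R)
    (nu : probability (measurableTypeR R) R) : Prop :=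
  forall f : R -> R, continuous f -> bounded_fun f ->
    (\int[mu n]_x (f x)%:E)%E @[n --> \oo] --> (\int[nu]_x (f x)%:E)%E.

Definition cvg_in_distribution d (T : measurableType d) (R : realType)
    (P : nat -> probability T R) (X : forall n, {RV P n >-> R})
    (nu : probability (measurableTypeR R) R) : Prop :=
  weak_cvg (fun n => distribution (P n) (X n)) nu.

Definition lattice_path := seq (nat * nat).

HB.instance Definition _ := Choice.on lattice_path.
HB.instance Definition _ := isPointed.Build lattice_path [::].
HB.instance Definition _ := @isMeasurable.Build default_measure_display
  lattice_path discrete_measurable discrete_measurable0
  discrete_measurableC discrete_measurableU.

Lemma measurable_lattice_path (A : set lattice_path) : measurable A.
Proof. by []. Qed.

Definition up_right_step (u v : nat * nat) : bool :=
  (v == (u.1.+1, u.2)) || (v == (u.1, u.2.+1)).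

(* A path is recorded as the list of its points in order; coordinates are
   1-based.  Consecutive points are distinct and increasing, so this is the same
   as the collection of points, and a sum over the list is a sum over it. *)
Definition up_right_paths (M N : nat) : set lattice_path :=
  [set s : lattice_path | [/\ size s = (M + N - 1)%N,
    head (0, 0)%N s = (1, 1)%N, last (0, 0)%N s = (M, N) &
    sorted up_right_step s]].

Definition square (M N : nat) : set (nat * nat) :=
  [set ij | (1 <= ij.1 <= M)%N && (1 <= ij.2 <= N)%N].

Lemma up_right_paths_square (M N : nat) (s : lattice_path) :
  up_right_paths M N s -> [set` s] `<=` square M N.
Proof.
case: s => [|x s] [_ /= hx hl hs]; first by [].
pose r (u v : nat * nat) := (u.1 <= v.1)%N && (u.2 <= v.2)%N.
have rtr : transitive r.
  move=> [a b] [c d] [e f] /andP[/= h1 h2] /andP[/= h3 h4].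
  by rewrite /r /= (leq_trans h1 h3) (leq_trans h2 h4).
have rxx u : r u u by rewrite /r !leqnn.
have hp : path r x s.
  apply: sub_path hs => -[a b] [c d] /orP[] /eqP[-> ->];
  by rewrite /r /= leqnSn leqnn.
move=> [i j] /= hin.
have /andP[/= i1 j1] : r (1, 1)%N (i, j).
  move: hin; rewrite inE -hx => /orP[/eqP -> //|hin].
  by move: (order_path_min rtr hp) => /allP /(_ _ hin).
have /andP[/= iM jN] : r (i, j) (M, N).
  rewrite -hl; move: hin; rewrite inE => /orP[/eqP ->|hin].
    move: (mem_last x s); rewrite inE => /orP[/eqP -> //|].
    by move: (order_path_min rtr hp) => /allP h /h.
  case/splitPr: hin hp => s1 s2; rewrite cat_path /= last_cat /=.
  move=> /and3P[_ _ hp].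
  move: (mem_last (i, j) s2); rewrite inE => /orP[/eqP -> //|].
  by move: (order_path_min rtr hp) => /allP h /h.
by rewrite /square /= i1 j1 iM jN.
Qed.

Lemma finite_up_right_paths (M N : nat) : finite_set (up_right_paths M N).
Proof.
pose T := ((M + N - 1).-tuple ('I_M.+1 * 'I_N.+1))%type.
pose g (t : T) : lattice_path := [seq (nat_of_ord u.1, nat_of_ord u.2) | u <- t].
apply: (@sub_finite_set _ _ (range g)); last first.
  exact/finite_image/finite_finset.
move=> s hs.
have sz : size [seq ((inord u.1 : 'I_M.+1), (inord u.2 : 'I_N.+1)) | u <- s]
    == (M + N - 1)%N by rewrite size_map; case: hs => ->.
exists (Tuple sz) => //; rewrite /g /= -map_comp -[RHS]map_id.
apply/eq_in_map => -[i j] ijs /=.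
have /andP[/= /andP[_ iM] /andP[_ jN]] := up_right_paths_square hs ijs.
by rewrite !inordK.
Qed.

Lemma up_right_paths_neq0 (M N : nat) : (0 < M)%N -> (0 < N)%N ->
  up_right_paths M N !=set0.
Proof.
move=> + N0; elim: M => // -[_ _|M /(_ erefl)[s [sz h l hs]] _].
  case: N N0 => // N _; elim: N => [|N [s [sz h l hs]]].
    by exists [:: (1, 1)%N].
  exists (rcons s (1, N.+2)%N); case: s => [|x s] // in sz h l hs *.
  split => //=; first by rewrite size_rcons; move: sz => /= ->.
  - by rewrite last_rcons.
  - by move: hs l => /= hs l; rewrite rcons_path hs l /up_right_step eqxx orbT.
exists (rcons s (M.+2, N)); case: s => [|x s] // in sz h l hs *.
split => //=; first by rewrite size_rcons; move: sz => /= ->; lia.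
- by rewrite last_rcons.
- by move: hs l => /= hs l; rewrite rcons_path hs l /up_right_step eqxx.
Qed.

(* The Dirac mass at [::] only matters when the finite set A is empty, i.e. for
   up_right_paths M N with M = 0 or N = 0: mnormalize then falls back on it. *)
Definition uniform_on (R : realType) (A : set lattice_path) :
    probability lattice_path R :=
  mnormalize (mrestr (@counting lattice_path R) (measurable_lattice_path A))
    \d_([::] : lattice_path).

Lemma uniform_onE (R : realType) (A B : set lattice_path) :
  finite_set A -> A !=set0 ->
  uniform_on R A B =
  ((#|` fset_set (B `&` A)|)%:R / (#|` fset_set A|)%:R)%:E.
Proof.
move=> fA [a Aa].
have A0 : (#|` fset_set A|)%:R != 0 :> R.
  rewrite pnatr_eq0 cardfs_eq0; apply/negP => /eqP /fset_set_set0 h.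
  by have := h fA; apply/eqP/set0P; exists a.
have cE (C : set lattice_path) : finite_set C ->
    @counting lattice_path R C = (#|` fset_set C|)%:R%:E.
  by move=> fC; rewrite /counting asboolT.
rewrite /uniform_on /= /mnormalize /= /mrestr !setTI cE//.
rewrite eqe (negbTE A0) /= cE -?EFinM//.
by apply: sub_finite_set fA => x [].
Qed.

Definition rescaled_sum (R : realType) (w : nat -> nat -> R) (M N : nat)
    (s : lattice_path) : R :=
  (Num.sqrt (M + N - 1)%:R)^-1 * \sum_(ij <- s) w ij.1 ij.2.

Lemma measurable_rescaled_sum (R : realType) (w : nat -> nat -> R) M N :
  measurable_fun setT (rescaled_sum w M N).
Proof. by []. Qed.

HB.instance Definition _ (R : realType) (w : nat -> nat -> R) (M N : nat) :=
  isMeasurableFun.Build _ _ _ _ (rescaled_sum w M N)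
    (measurable_rescaled_sum w M N).

(* Main.v *)
(* For a smooth test function f let A_N be the average over the paths of f of the rescaled
   sum, minus the Gaussian integral of f; A_N depends on the environment only.  Replace the
   weights one at a time by Gaussian increments, as in Lindeberg's argument.  Replacing
   w_v changes the average by at most O(p_v n^(-1/2)), where n = M + N - 1 and p_v is the
   probability that the random path visits v, and the terms of first and second order of
   this change have mean zero given the other weights.  Hence 1 + E((n^(1/4) A_N)^8)
   is multiplied at each replacement by at most
   1 + O(p_v n^(-5/4) + p_v^2 n^(-1/2)).  The sum of the p_v is n, and the estimate
   p_v = O(l^(-1/2) + (n - l)^(-1/2)) at level l, from binomial coefficients, bounds the sum
   of the p_v^2 by O(sqrt n).  Therefore E(A_N^8) = O(n^(-2)), which is summable, and A_N
   tends to 0 almost surely.  Dilated and translated cubic splines form a countable family of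
   test functions that suffices for weak convergence. *)
Require Import Defs.
From HB Require Import structures.
From mathcomp Require Import all_boot all_order all_algebra.
From mathcomp Require Import finmap.
From mathcomp Require Import all_classical all_reals all_analysis.
From mathcomp Require Import measurable_realfun.
From mathcomp Require Import ring lra zify.

Set Implicit Arguments.
Unset Strict Implicit.
Unset Printing Implicit Defensive.

Import Order.TTheory GRing.Theory Num.Def Num.Theory.
Import numFieldNormedType.Exports.

Local Open Scope classical_set_scope.
Local Open Scope ring_scope.


(** * Real-valued integrals *)

(** A statement for almost every environment needs a rate. The fluctuations of A_N have order at
    most (n^(-1) sum of the p_v^2)^(1/2) = O(n^(-1/4)); a fourth moment would thus give only O(1/n),
    which is not summable, whereas the eighth gives O(n^(-2)). No Gaussian variables are adjoined to
    the probability space: a Gaussian increment acts on a test function by convolution. The average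
    over paths is linear, so each path can be treated alone: a path with k replaced points
    contributes f convolved k times, taken at the rescaled sum of its remaining weights. All paths
    have n points, so once every weight is replaced, each path contributes exactly the Gaussian
    integral and A_N is 0. The induction starts from this state and puts the weights back one at a
    time. The 1 added to the moment dominates the lower powers of A_N in the expansion of the eighth
    power; this makes each step a multiplication and the total bound an exponential of a sum over
    points. Only paths through v feel the weight w_v, whence the factor p_v; it is squared in the
    main term because the linear part of the increment averages out. *)

Section real_integrable.
Context d (T : measurableType d) (R : realType) (mu : {measure set T -> \bar R}).
Implicit Types f g : T -> R.

Lemma integrable_EFinD f g : mu.-integrable setT (EFin \o f) ->
  mu.-integrable setT (EFin \o g) ->
  mu.-integrable setT (EFin \o (fun x => f x + g x)).
Proof.
move=> fi gi; have := integrableD measurableT fi gi.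
by apply: eq_integrable => // x _; rewrite /= EFinD.
Qed.

Lemma integrable_EFinZ k f : mu.-integrable setT (EFin \o f) ->
  mu.-integrable setT (EFin \o (fun x => k * f x)).
Proof.
move=> fi; have := integrableZl measurableT k fi.
by apply: eq_integrable => // x _; rewrite /= EFinM.
Qed.

Lemma integrable_EFinN f : mu.-integrable setT (EFin \o f) ->
  mu.-integrable setT (EFin \o (fun x => - f x)).
Proof.
move=> fi; have := integrable_EFinZ (-1) fi.
by apply: eq_integrable => // x _; rewrite /= mulN1r.
Qed.

Lemma le_integrable_EFin f g : measurable_fun setT f ->
  (forall x, `|f x| <= g x) -> mu.-integrable setT (EFin \o g) ->
  mu.-integrable setT (EFin \o f).
Proof.
move=> mf fg; apply: le_integrable => //; first exact/measurable_EFinP.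
by move=> x _ /=; rewrite lee_fin (le_trans (fg x))// ler_norm.
Qed.

Lemma ge0_integrable_EFin f (c : R) : measurable_fun setT f ->
  (forall x, 0 <= f x) -> (\int[mu]_x (f x)%:E <= c%:E)%E ->
  mu.-integrable setT (EFin \o f).
Proof.
move=> mf f0 fc; apply/integrableP; split; first exact/measurable_EFinP.
under eq_integral do rewrite /= ger0_norm//.
by rewrite (le_lt_trans fc)// ltry.
Qed.

Lemma RintegralT_le f g : mu.-integrable setT (EFin \o f) ->
  mu.-integrable setT (EFin \o g) -> (forall x, f x <= g x) ->
  \int[mu]_x f x <= \int[mu]_x g x.
Proof. by move=> fi gi fg; apply: le_Rintegral => // x _; exact: fg. Qed.

Lemma EFin_Rintegral f : mu.-integrable setT (EFin \o f) ->
  (\int[mu]_x f x)%:E = (\int[mu]_x (f x)%:E)%E.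
Proof. by move=> fi; rewrite fineK//; exact: integrable_fin_num. Qed.

Lemma integrable_EFin0 : mu.-integrable setT (EFin \o (fun=> 0 : R)).
Proof. exact: integrable0. Qed.

Lemma integrable_EFin_sum (I : Type) (s : seq I) (F : I -> T -> R) :
  (forall i, mu.-integrable setT (EFin \o F i)) ->
  mu.-integrable setT (EFin \o (fun x => \sum_(i <- s) F i x)).
Proof.
move=> iF; elim: s => [|i s ih].
  by under eq_fun do rewrite big_nil; exact: integrable_EFin0.
by under eq_fun do rewrite big_cons; exact: integrable_EFinD.
Qed.

Lemma Rintegral_sum (I : Type) (s : seq I) (F : I -> T -> R) :
  (forall i, mu.-integrable setT (EFin \o F i)) ->
  \int[mu]_x (\sum_(i <- s) F i x) = \sum_(i <- s) \int[mu]_x F i x.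
Proof.
move=> iF; elim: s => [|i s ih].
  under eq_Rintegral do rewrite big_nil.
  by rewrite big_nil /Rintegral integral0.
under eq_Rintegral do rewrite big_cons.
by rewrite RintegralD// ?ih ?big_cons//; exact: integrable_EFin_sum.
Qed.

End real_integrable.

Section real_integrable_probability.
Context d (T : measurableType d) (R : realType) (P : probability T R).
Implicit Types f g : T -> R.

Lemma integrable_EFin_cst (c : R) : P.-integrable setT (EFin \o (fun=> c)).
Proof. exact: finite_measure_integrable_cst. Qed.

Lemma integrable_EFin_bounded f (c : R) : measurable_fun setT f ->
  (forall x, `|f x| <= c) -> P.-integrable setT (EFin \o f).
Proof. by move=> mf fc; apply: (le_integrable_EFin mf fc); exact: integrable_EFin_cst. Qed.

Lemma Rintegral_probability_cst (c : R) : \int[P]_x c = c.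
Proof. by rewrite Rintegral_cst//= probability_setT mulr1. Qed.

End real_integrable_probability.

(** * Gaussian measures *)

(** The Radon-Nikodym derivative and the explicit density have the same integral over every
    measurable set, so they agree almost everywhere and may be exchanged under the integral. *)
Lemma ge0_integral_normal_prob (R : realType) (m s : R)
    (f : measurableTypeR R -> \bar R) :
  measurable_fun setT f -> (forall x, 0 <= f x)%E ->
  (\int[normal_prob m s]_x f x =
   \int[lebesgue_measure]_x (f x * (normal_pdf m s x)%:E))%E.
Proof.
move=> mf f0; have dom := @normal_prob_dominates R m s.
rewrite -(Radon_Nikodym_SigmaFinite.change_of_variables dom) //.
apply: ae_eq_integral => //.
- apply: emeasurable_funM => //.
  exact: measurable_int (Radon_Nikodym_SigmaFinite.f_integrable dom).
- apply: emeasurable_funM => //.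
  by apply/measurable_EFinP; exact: measurable_normal_pdf.
- apply: ae_eqe_mul2l; apply: integral_ae_eq => //.
  + exact: (Radon_Nikodym_SigmaFinite.f_integrable dom).
  + by apply/measurable_EFinP; exact: measurable_normal_pdf.
  + by move=> E _ mE; rewrite -Radon_Nikodym_SigmaFinite.f_integral.
Qed.

Lemma ge0_integral_lebesgue_shift (R : realType) (f : R -> R) (c : R) :
  continuous f -> (forall x, 0 <= f x) ->
  (\int[lebesgue_measure]_x (f x)%:E = \int[lebesgue_measure]_x (f (x + c))%:E)%E.
Proof.
move=> cf f0.
have F'E : (fun x : R^o => x + c)^`()%classic = cst 1.
  apply/funext => x; rewrite derive1E deriveD// derive_id derive_cst addr0//.
rewrite (@increasing_ge0_integration_by_substitutionT _ (fun x => x + c))//.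
- by apply: eq_integral => x _; rewrite F'E !fctE/= mulr1.
- by move=> x y xy; rewrite ltrD2r.
- by rewrite F'E => ?; exact: cvg_cst.
- by rewrite F'E; exact: is_cvg_cst.
- by rewrite F'E; exact: is_cvg_cst.
- exact: cvg_addrr_Ny.
- exact: cvg_addrr.
Qed.

(** Completing the square in [y]: the joint density of [y] and the sum [u] is the density of [u]
    times the conditional density of [y] given [u]. *)
Lemma normal_pdf_conv (R : realType) (a b c u y : R) :
  0 < a -> 0 < b -> 0 < c -> c ^+ 2 = a ^+ 2 + b ^+ 2 ->
  normal_pdf 0 a y * normal_pdf 0 b (u - y) =
  normal_pdf 0 c u * normal_pdf (u * a ^+ 2 / c ^+ 2) (a * b / c) y.
Proof.
move=> a0 b0 c0 cE.
have a' : a != 0 by rewrite gt_eqF.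
have b' : b != 0 by rewrite gt_eqF.
have c' : c != 0 by rewrite gt_eqF.
have d' : a * b / c != 0 by rewrite !mulf_neq0// invr_eq0.
rewrite !normal_pdfE// mulrACA [RHS]mulrACA; congr (_ * _).
  rewrite /normal_peak -!invfM; congr (_^-1).
  rewrite -!sqrtrM ?mulrn_wge0 ?mulr_ge0 ?sqr_ge0 ?pi_ge0 ?(ltW a0) ?(ltW c0)//.
  by congr Num.sqrt; field.
rewrite /normal_fun -!expRD; congr expR.
have ab0 : a ^+ 2 + b ^+ 2 != 0 by rewrite -cE expf_neq0.
by rewrite cE exprMn exprVn cE; field; rewrite ab0 b' a'.
Qed.

(** After a translation in the inner integral, Tonelli's theorem puts the integral over [y] inside,
    where the conditional density integrates to 1. Nonnegativity of [f] takes the place of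
    integrability. *)
Lemma normal_prob_conv (R : realType) (a b c : R) (f : R -> R) :
  0 < a -> 0 < b -> 0 < c -> c ^+ 2 = a ^+ 2 + b ^+ 2 ->
  continuous f -> (forall x, 0 <= f x) ->
  (\int[normal_prob 0 a]_y \int[normal_prob 0 b]_z (f (y + z))%:E =
   \int[normal_prob 0 c]_u (f u)%:E)%E.
Proof.
move=> a0 b0 c0 cE cf f0.
have mf : measurable_fun [set: R] f by exact: continuous_measurable_fun.
have mpdf m s : measurable_fun [set: R] (normal_pdf m s : R -> R).
  exact: measurable_normal_pdf.
pose T := measurableTypeR R.
have m1 : @measurable_fun _ _ (T * T)%type R setT fst by exact: measurable_fst.
have m2 : @measurable_fun _ _ (T * T)%type R setT snd by exact: measurable_snd.
have cpdf s : 0 < s -> continuous (normal_pdf 0 s).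
  by move=> s0; apply: continuous_normal_pdf; rewrite gt_eqF.
have inner y : (\int[normal_prob 0 b]_z (f (y + z))%:E =
    \int[lebesgue_measure]_u (f u * normal_pdf 0 b (u - y))%:E)%E.
  rewrite ge0_integral_normal_prob; last first.
  - by move=> z; rewrite lee_fin.
  - apply/measurable_EFinP; apply: measurableT_comp => //.
    exact: measurable_funD.
  rewrite (@ge0_integral_lebesgue_shift _ (fun u => f u * normal_pdf 0 b (u - y)) y).
  - by apply: eq_integral => z _; rewrite addrK addrC EFinM.
  - move=> x; apply: cvgM; first exact: cf.
    apply: (cvg_comp (fun x => x - y) (normal_pdf 0 b)); last exact: cpdf.
    by apply: (@cvgB _ R^o) => //; exact: cvg_cst.
  - by move=> x; rewrite mulr_ge0 ?normal_pdf_ge0.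
under eq_integral do rewrite inner.
pose G (z : measurableTypeR R * measurableTypeR R) : \bar R :=
  (f z.2 * (normal_pdf 0 a z.1 * normal_pdf 0 b (z.2 - z.1)))%:E.
have mG0 : measurable_fun setT (fun z : measurableTypeR R * measurableTypeR R =>
    (f z.2 * normal_pdf 0 b (z.2 - z.1))%:E).
  apply/measurable_EFinP; apply: measurable_funM.
    exact: measurableT_comp mf m2.
  exact: measurableT_comp (mpdf _ _) (measurable_funB m2 m1).
have mG : measurable_fun setT G.
  apply/measurable_EFinP; apply: measurable_funM.
    exact: measurableT_comp mf m2.
  apply: measurable_funM.
    exact: measurableT_comp (mpdf _ _) m1.
  exact: measurableT_comp (mpdf _ _) (measurable_funB m2 m1).
have G0 z : (0 <= G z)%E by rewrite lee_fin !mulr_ge0 ?normal_pdf_ge0.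
rewrite [LHS]ge0_integral_normal_prob; last first.
- move=> y; apply: integral_ge0 => u _.
  by rewrite lee_fin mulr_ge0 ?normal_pdf_ge0.
- apply: (measurable_fun_fubini_tonelli_F
    (m2 := lebesgue_measure : {measure set (measurableTypeR R) -> \bar R}) _ mG0) => z.
  by rewrite lee_fin mulr_ge0 ?normal_pdf_ge0.
transitivity (\int[lebesgue_measure]_y \int[lebesgue_measure]_u G (y, u))%E.
  apply: eq_integral => y _; rewrite muleC -ge0_integralZl ?lee_fin ?normal_pdf_ge0//.
  - apply: eq_integral => u _; rewrite /G/= -EFinM; congr EFin; ring.
  - apply/measurable_EFinP; apply: measurable_funM => //.
    apply: measurableT_comp => //; exact: measurable_funB.
  - by move=> u _; rewrite lee_fin mulr_ge0 ?normal_pdf_ge0.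
rewrite fubini_tonelli// [RHS]ge0_integral_normal_prob; last first.
- by move=> u; rewrite lee_fin.
- exact/measurable_EFinP.
apply: eq_integral => u _; rewrite /G/=.
under eq_integral do rewrite (normal_pdf_conv _ _ a0 b0 c0 cE) mulrA EFinM.
rewrite ge0_integralZl ?integral_normal_pdf ?mule1 ?EFinM//.
- by apply/measurable_EFinP; exact: mpdf.
- by move=> y _; rewrite lee_fin normal_pdf_ge0.
- by rewrite mule_ge0 ?lee_fin ?normal_pdf_ge0.
Qed.

Section normal_moments.
Variables (R : realType) (s : R).
Hypothesis s_gt0 : 0 < s.
Local Notation nu := (normal_prob 0 s).
Let T := measurableTypeR R.

(** The integrand is the ratio of the Gaussian densities with means [m] and 0. This integral and the
    next one are the only ones computed exactly; all moments below are extracted from them by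
    inequalities. *)
Lemma normal_exp_linear (m : R) :
  (\int[nu]_y (expR (m * y / s ^+ 2 - m ^+ 2 / (2 * s ^+ 2)))%:E = 1)%E.
Proof.
have s0 : s != 0 by rewrite gt_eqF.
have mT : @measurable_fun _ _ T R setT id by exact: measurable_id.
rewrite ge0_integral_normal_prob.
- rewrite -(integral_normal_pdf m s); apply: eq_integral => y _.
  rewrite -EFinM !normal_pdfE// mulrCA; congr ((_ * _)%:E).
  by rewrite /normal_fun -expRD; congr expR; field.
- apply/measurable_EFinP; apply: measurableT_comp => //.
  apply: measurable_funB => //; apply: measurable_funM => //.
- by move=> y; rewrite lee_fin expR_ge0.
Qed.

(** The integrand is the ratio of the centred densities with deviations [t] and [s], up to the
    quotient [t / s] of their peaks. *)
Lemma normal_exp_square (t : R) : 0 < t ->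
  (\int[nu]_y (expR ((s ^- 2 - t ^- 2) * y ^+ 2 / 2))%:E = (t / s)%:E)%E.
Proof.
move=> t0.
have s0 : s != 0 by rewrite gt_eqF.
have t0' : t != 0 by rewrite gt_eqF.
have mT : @measurable_fun _ _ T R setT id by exact: measurable_id.
rewrite ge0_integral_normal_prob.
- rewrite -[RHS]mule1 -(integral_normal_pdf 0 t) -ge0_integralZl//.
  + apply: eq_integral => y _.
    rewrite -!EFinM !normal_pdfE// mulrCA mulrA; congr EFin.
    have -> : normal_peak s = t / s * normal_peak t.
      rewrite /normal_peak -!mulrnAr !(sqrtrM _ (sqr_ge0 _)).
      by rewrite !sqrtr_sqr !gtr0_norm// !invfM mulrACA divff// mul1r mulrC.
    rewrite -!mulrA; congr (_ * (_ * (_ * _))).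
    by rewrite /normal_fun -expRD; congr expR; field; rewrite s0 t0'.
  + by apply/measurable_EFinP; exact: measurable_normal_pdf.
  + by move=> y _; rewrite lee_fin normal_pdf_ge0.
  + by rewrite lee_fin divr_ge0 // ltW.
- apply/measurable_EFinP; apply: measurableT_comp => //.
  apply: measurable_funM => //; apply: measurable_funM => //.
- by move=> y; rewrite lee_fin expR_ge0.
Qed.

Lemma normal_exp_integrable (t : R) : 0 < t ->
  nu.-integrable setT (EFin \o (fun y => expR ((s ^- 2 - t ^- 2) * y ^+ 2 / 2))).
Proof.
move=> t0; apply: (@ge0_integrable_EFin _ _ _ _ _ (t / s)).
- have mT : @measurable_fun _ _ T R setT id by exact: measurable_id.
  apply: measurableT_comp => //.
  by apply: measurable_funM => //; apply: measurable_funM.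
- by move=> y; rewrite expR_ge0.
- by rewrite normal_exp_square.
Qed.

(** The exponential is the one of [normal_exp_square] with [t] = sqrt 2 times [s], whose integral is
    sqrt 2, at most 2. This is how 33 becomes the 66 of the third-moment bound. *)
Lemma normal_cube_exp (y : R) :
  `|y| ^+ 3 <= s ^+ 3 * (33 * expR ((s ^- 2 - (Num.sqrt 2 * s) ^- 2) * y ^+ 2 / 2)).
Proof.
have s0 : s != 0 by rewrite gt_eqF.
set z := `|y| / s.
have z0 : 0 <= z by rewrite divr_ge0// ltW.
have -> : `|y| = s * z by rewrite /z mulrC divfK.
have -> : (s ^- 2 - (Num.sqrt 2 * s) ^- 2) * y ^+ 2 / 2 = z ^+ 2 / 4.
  rewrite exprMn sqr_sqrtr// /z exprMn real_normK ?num_real//.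
  by field.
rewrite exprMn ler_pM2l ?exprn_gt0//.
have h1 : 1 + z ^+ 2 / 8 <= expR (z ^+ 2 / 8) by apply: expR_ge1Dx.
have -> : z ^+ 2 / 4 = z ^+ 2 / 8 + z ^+ 2 / 8 by field.
rewrite expRD.
have : (1 + z ^+ 2 / 8) ^+ 2 <= expR (z ^+ 2 / 8) * expR (z ^+ 2 / 8).
  by rewrite expr2 ler_pM// addr_ge0// divr_ge0// sqr_ge0.
set e := expR _ * expR _ => he.
(* z^3 is at most (z^2 + z^4) / 2, and 33 / 64, the coefficient of z^4 on the right, exceeds 1 /
   2. *)
have : z ^+ 3 <= 33 * (1 + z ^+ 2 / 8) ^+ 2.
  have : 0 <= (z - 1) ^+ 2 by rewrite sqr_ge0.
  have : 0 <= z ^+ 2 by rewrite sqr_ge0.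
  have : 0 <= z ^+ 2 * (z - 1) ^+ 2 by rewrite mulr_ge0 ?sqr_ge0.
  by nra.
by lra.
Qed.

Lemma normal_cube_integrable : nu.-integrable setT (EFin \o (fun y => `|y| ^+ 3)).
Proof.
have t0 : 0 < Num.sqrt 2 * s by rewrite mulr_gt0.
apply: (le_integrable_EFin _ _
  (integrable_EFinZ (s ^+ 3) (integrable_EFinZ 33 (normal_exp_integrable t0)))); last first.
  by move=> y; rewrite ger0_norm ?exprn_ge0//; exact: normal_cube_exp.
have mT : @measurable_fun _ _ T R setT id by exact: measurable_id.
  by apply: measurable_funX; exact: (measurableT_comp (@normr_measurable R setT) mT).
Qed.

Lemma normal_cube_bound : \int[nu]_y (`|y| ^+ 3) <= 66 * s ^+ 3.
Proof.
have t0 : 0 < Num.sqrt 2 * s by rewrite mulr_gt0.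
have iE := normal_exp_integrable t0.
have iE33 := integrable_EFinZ 33 iE.
apply: le_trans (RintegralT_le normal_cube_integrable
  (integrable_EFinZ (s ^+ 3) iE33) normal_cube_exp) _.
rewrite !RintegralZl// /Rintegral normal_exp_square//= mulfK ?gt_eqF//.
rewrite [leRHS]mulrC ler_pM2l ?exprn_gt0//.
suff : Num.sqrt 2 <= 2 :> R by lra.
by rewrite -[leRHS]ger0_norm// -sqrtr_sqr ler_wsqrtr// expr2; lra.
Qed.

Lemma normal_sq_integrable : nu.-integrable setT (EFin \o (fun y => y ^+ 2)).
Proof.
apply: le_integrable_EFin; last first.
- exact: (integrable_EFinD (integrable_EFin_cst nu 1) normal_cube_integrable).
- move=> y; rewrite ger0_norm ?sqr_ge0// -real_normK ?num_real//.
  have : 0 <= `|y| by []. 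
  set z := `|y| => z0.
  have [z1|z1] := leP z 1.
    have : 0 <= z ^+ 3 by rewrite exprn_ge0.
    by rewrite expr2; nra.
  by rewrite [z ^+ 3]exprS; have := sqr_ge0 z; nra.
- have mT : @measurable_fun _ _ T R setT id by exact: measurable_id.
  exact: measurable_funX.
Qed.

Lemma normal_id_integrable : nu.-integrable setT (EFin \o id).
Proof.
apply: le_integrable_EFin; last first.
- exact: (integrable_EFinD (integrable_EFin_cst nu 1) normal_sq_integrable).
- move=> y /=; rewrite -[y ^+ 2]real_normK ?num_real//.
  have : 0 <= `|y| by [].
  by set z := `|y| => z0; rewrite expr2; nra.
- exact: measurable_id.
Qed.

(** Integrating 1 + x <= exp x against [normal_exp_linear] gives m mu <= m^2 / 2 for every m; the
    choice m = mu forces mu = 0. *)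
Lemma normal_mean : \int[nu]_y y = 0.
Proof.
have s0 : s != 0 by rewrite gt_eqF.
have iid := normal_id_integrable.
pose mu := \int[nu]_y y; rewrite -/mu.
have key m : m * mu <= m ^+ 2 / 2.
  have ilin : nu.-integrable setT
      (EFin \o (fun y => 1 - m ^+ 2 / (2 * s ^+ 2) + m / s ^+ 2 * y)).
    exact: (integrable_EFinD (integrable_EFin_cst nu _) (integrable_EFinZ _ iid)).
  have iexp : nu.-integrable setT
      (EFin \o (fun y => expR (m * y / s ^+ 2 - m ^+ 2 / (2 * s ^+ 2)))).
    apply: (@ge0_integrable_EFin _ _ _ _ _ 1).
    - have mT : @measurable_fun _ _ T R setT id by exact: measurable_id.
      apply: measurableT_comp => //; apply: measurable_funB => //.
      by apply: measurable_funM => //; apply: measurable_funM.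
    - by move=> y; rewrite expR_ge0.
    - by rewrite normal_exp_linear.
  have := RintegralT_le ilin iexp.
  have -> : \int[nu]_y expR (m * y / s ^+ 2 - m ^+ 2 / (2 * s ^+ 2)) = 1.
    by rewrite /Rintegral normal_exp_linear.
  rewrite RintegralD ?RintegralZl//; last 2 first.
    exact: integrable_EFin_cst.
    exact: (integrable_EFinZ _ iid).
  rewrite Rintegral_probability_cst => h.
  have {h} : 1 - m ^+ 2 / (2 * s ^+ 2) + m / s ^+ 2 * mu <= 1.
    apply: h => y; apply: le_trans (expR_ge1Dx _); rewrite le_eqVlt; apply/orP; left.
    by apply/eqP; field.
  have -> : m / s ^+ 2 * mu = (m * mu) / s ^+ 2 by rewrite mulrAC.
  rewrite invfM mulrA => h.
  by rewrite -(ler_pM2r (_ : 0 < (s ^+ 2)^-1)) ?invr_gt0 ?exprn_gt0//; lra.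
apply/eqP; rewrite -sqrf_eq0 eq_le sqr_ge0 andbT.
by have := key mu; rewrite -expr2; lra.
Qed.

(** The same inequality against [normal_exp_square], with deviation t s, compares the two sides near
    t = 1: values t > 1 give V <= 1 and values t < 1 give V >= 1. The contradictions use t = 1 + h
    and t = 1 - h, with h a quarter of the distance from V to 1. *)
Lemma normal_variance : \int[nu]_y (y ^+ 2) = s ^+ 2.
Proof.
have s0 : s != 0 by rewrite gt_eqF.
have isq := normal_sq_integrable.
pose V := (\int[nu]_y (y ^+ 2)) / s ^+ 2.
have -> : \int[nu]_y (y ^+ 2) = V * s ^+ 2 by rewrite divfK// expf_neq0.
suff -> : V = 1 by rewrite mul1r.
have key t : 0 < t -> (t ^+ 2 - 1) * V / 2 <= t ^+ 2 * (t - 1).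
  move=> t0; have ts0 : 0 < t * s by rewrite mulr_gt0.
  have t0' : t != 0 by rewrite gt_eqF.
  pose k := (s ^- 2 - (t * s) ^- 2) / 2.
  have := RintegralT_le
    (integrable_EFinD (integrable_EFin_cst nu 1) (integrable_EFinZ k isq))
    (normal_exp_integrable ts0).
  rewrite RintegralD ?RintegralZl//; last 2 first.
    exact: integrable_EFin_cst.
    exact: (integrable_EFinZ _ isq).
  have -> : \int[nu]_y expR ((s ^- 2 - (t * s) ^- 2) * y ^+ 2 / 2) = t.
    by rewrite /Rintegral normal_exp_square//= mulfK.
  rewrite Rintegral_probability_cst => h.
  have {h} : 1 + k * \int[nu]_y (y ^+ 2) <= t.
    by apply: h => y; rewrite /k mulrAC; exact: expR_ge1Dx.
  have -> : k * \int[nu]_y (y ^+ 2) = (t ^+ 2 - 1) * V / 2 / t ^+ 2.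
    by rewrite /k /V; field; rewrite s0 t0'.
  have t2 : 0 < t ^+ 2 by rewrite exprn_gt0.
  by rewrite -lerBrDl ler_pdivrMr// [leRHS]mulrC.
apply/eqP; rewrite eq_le; apply/andP; split; rewrite leNgt; apply/negP => hV.
- pose h := (V - 1) / 4.
  have VE : V = 1 + 4 * h by rewrite /h; field.
  have h0 : 0 < h by rewrite /h; lra.
  have := key (1 + h) ltac:(lra); rewrite VE.
  have -> : ((1 + h) ^+ 2 - 1) * (1 + 4 * h) / 2 = h * ((2 + h) * (1 + 4 * h) / 2) by field.
  have -> : (1 + h) ^+ 2 * (1 + h - 1) = h * (1 + h) ^+ 2 by ring.
  by rewrite ler_pM2l// expr2; nra.
- pose h := (1 - V) / 4.
  have VE : V = 1 - 4 * h by rewrite /h; field.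
  have h0 : 0 < h by rewrite /h; lra.
  have V0 : 0 <= V by rewrite /V divr_ge0 ?sqr_ge0// Rintegral_ge0// => y _; rewrite sqr_ge0.
  have := key (1 - h) ltac:(lra); rewrite VE.
  have -> : ((1 - h) ^+ 2 - 1) * (1 - 4 * h) / 2 = - (h * ((2 - h) * (1 - 4 * h) / 2)) by field.
  have -> : (1 - h) ^+ 2 * (1 - h - 1) = - (h * (1 - h) ^+ 2) by ring.
  by rewrite lerN2 ler_pM2l// expr2; nra.
Qed.

End normal_moments.

(** * Gaussian averages of smooth functions *)

(** [f1] and [f2] stand for the first two derivatives, but only inequalities are recorded. These
    pass to averages over translates with the same [C], without differentiation under an
    integral. *)
Record taylor_class (R : realType) (C : R) (f f1 f2 : R -> R) : Prop := TaylorClass {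
  tc_bound : forall x, `|f x| <= C;
  tc_bound1 : forall x, `|f1 x| <= C;
  tc_bound2 : forall x, `|f2 x| <= C;
  tc_lip : forall x y, `|f (x + y) - f x| <= C * `|y|;
  tc_lip1 : forall x y, `|f1 (x + y) - f1 x| <= C * `|y|;
  tc_lip2 : forall x y, `|f2 (x + y) - f2 x| <= C * `|y|;
  tc_taylor : forall x y,
    `|f (x + y) - f x - y * f1 x - y ^+ 2 / 2 * f2 x| <= C * `|y| ^+ 3 }.

Lemma lipschitz_continuousR (R : realType) (C : R) (f : R -> R) :
  (forall x y, `|f (x + y) - f x| <= C * `|y|) -> continuous f.
Proof.
move=> lf x; apply/cvgrPdist_le => e e0; near=> y.
have -> : y = x + (y - x) by rewrite addrCA subrr addr0.
rewrite distrC (le_trans (lf _ _))//.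
have C1 : 0 < `|C| + 1 by rewrite ltr_wpDl.
apply: (@le_trans _ _ ((`|C| + 1) * `|y - x|)).
  by rewrite ler_wpM2r// (le_trans (ler_norm _))// lerDl.
rewrite -ler_pdivlMl//.
near: y; rewrite -normrN; under eq_near do rewrite distrC.
by apply: cvgr_dist_le => //; rewrite mulr_gt0// invr_gt0.
Unshelve. all: by end_near. Qed.

Lemma Rintegral_norm_le d (T : measurableType d) (R : realType)
    (P : probability T R) (f g : T -> R) :
  measurable_fun setT f -> (forall x, `|f x| <= g x) ->
  P.-integrable setT (EFin \o g) -> `|\int[P]_x f x| <= \int[P]_x g x.
Proof.
move=> mf fg ig; have fi := le_integrable_EFin mf fg ig.
apply: le_trans (le_normr_Rintegral measurableT fi) _.
apply: RintegralT_le => //; apply: (le_integrable_EFin _ _ ig).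
  exact: measurableT_comp.
by move=> x; rewrite normr_id.
Qed.

Section gaussian_average.
Variables (R : realType) (s : R).
Hypothesis s_gt0 : 0 < s.
Local Notation nu := (normal_prob 0 s).

Definition gauss_avg (f : R -> R) (x : R) : R := \int[nu]_y f (x + y).

Lemma measurable_shift (f : R -> R) (x : R) : continuous f ->
  measurable_fun (setT : set (measurableTypeR R)) (fun y => f (x + y)).
Proof.
move=> cf; apply: continuous_measurable_fun => y.
apply: (cvg_comp (fun y => x + y) f); last exact: cf.
by apply: (@cvgD _ R^o) => //; exact: cvg_cst.
Qed.

Lemma gauss_avg_bound C f : continuous f -> (forall x, `|f x| <= C) ->
  forall x, `|gauss_avg f x| <= C.
Proof.
move=> cf fC x; rewrite -[leRHS](Rintegral_probability_cst nu C).
apply: Rintegral_norm_le => //; first exact: measurable_shift.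
exact: integrable_EFin_cst.
Qed.

Lemma integrable_shift C f x : continuous f -> (forall x, `|f x| <= C) ->
  nu.-integrable setT (EFin \o (fun y => f (x + y))).
Proof.
move=> cf fC; apply: (@integrable_EFin_bounded _ _ _ _ _ C) => //.
exact: measurable_shift.
Qed.

Lemma gauss_avg_lip C f : continuous f -> (forall x, `|f x| <= C) ->
  (forall x y, `|f (x + y) - f x| <= C * `|y|) ->
  forall x y, `|gauss_avg f (x + y) - gauss_avg f x| <= C * `|y|.
Proof.
move=> cf fC lf x y; rewrite /gauss_avg -RintegralB//; last 2 first.
  exact: integrable_shift fC.
  exact: integrable_shift fC.
rewrite -[leRHS](Rintegral_probability_cst nu); apply: Rintegral_norm_le.
- by apply: measurable_funB; exact: measurable_shift.
- by move=> z; rewrite addrAC.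
- exact: integrable_EFin_cst.
Qed.

(** Each condition is linear in the three functions and uniform in the base point, so it can be
    integrated over the translation. *)
Lemma taylor_class_avg C f f1 f2 : taylor_class C f f1 f2 ->
  taylor_class C (gauss_avg f) (gauss_avg f1) (gauss_avg f2).
Proof.
move=> [b b1 b2 l l1 l2 t].
have c := lipschitz_continuousR l.
have c1 := lipschitz_continuousR l1.
have c2 := lipschitz_continuousR l2.
have i x := integrable_shift x c b.
have i1 x := integrable_shift x c1 b1.
have i2 x := integrable_shift x c2 b2.
split; try exact: gauss_avg_bound; try exact: gauss_avg_lip.
move=> x y; rewrite /gauss_avg -RintegralB// -!RintegralZl//.
rewrite -RintegralB//; last 2 first.
  exact: (integrable_EFinD (i _) (integrable_EFinN (i _))).
  exact: integrable_EFinZ.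
rewrite -RintegralB//; last 2 first.
  apply: (integrable_EFinD _ (integrable_EFinN (integrable_EFinZ _ (i1 _)))).
  exact: (integrable_EFinD (i _) (integrable_EFinN (i _))).
  exact: integrable_EFinZ.
rewrite -[leRHS](Rintegral_probability_cst nu); apply: Rintegral_norm_le.
- have m x' := measurable_shift x' c; have m1 := measurable_shift x c1.
  have m2 := measurable_shift x c2.
  apply: measurable_funB; last exact: measurable_funM.
  apply: measurable_funB; last exact: measurable_funM.
  exact: measurable_funB.
- by move=> z; rewrite [x + y + z]addrAC; exact: t.
- exact: integrable_EFin_cst.
Qed.

(** Integrate |y| <= s / 2 + y^2 / (2 s), which expresses that (s - |y|)^2 is nonnegative. *)
Lemma normal_abs_bound : \int[nu]_y `|y| <= s.
Proof.
have iabs : nu.-integrable setT (EFin \o (fun y => `|y|)).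
  exact: integrable_norm (normal_id_integrable s_gt0).
have isq := normal_sq_integrable s_gt0.
have := RintegralT_le iabs (integrable_EFinD (integrable_EFin_cst nu (s / 2))
  (integrable_EFinZ ((2 * s)^-1) isq)).
rewrite RintegralD//; last 2 first.
  exact: integrable_EFin_cst.
  exact: integrable_EFinZ.
rewrite Rintegral_probability_cst RintegralZl// normal_variance// => /(_ _)/le_trans; apply.
  move=> y; rewrite -subr_ge0 -[y ^+ 2]real_normK ?num_real//.
  have -> : s / 2 + (2 * s)^-1 * `|y| ^+ 2 - `|y| = (s - `|y|) ^+ 2 / (2 * s).
    by field; rewrite gt_eqF.
  by rewrite divr_ge0 ?sqr_ge0// mulr_ge0// ltW.
by rewrite le_eqVlt; apply/orP; left; apply/eqP; field; rewrite gt_eqF.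
Qed.

(** The crude size of one replacement: both terms are compared with [f x]. It suffices for the part
    of the eighth power that is at least quadratic in the increment. *)
Lemma gauss_avg_step1 C f f1 f2 x z : taylor_class C f f1 f2 ->
  `|f (x + z) - gauss_avg f x| <= C * (`|z| + s).
Proof.
move=> [b b1 b2 l l1 l2 t].
have c := lipschitz_continuousR l.
have C0 : 0 <= C by rewrite (le_trans _ (b 0)).
have i x' := integrable_shift x' c b.
have h : `|gauss_avg f x - f x| <= C * s.
  rewrite /gauss_avg -[X in _ - X](Rintegral_probability_cst nu) -RintegralB//; last 1 first.
    exact: integrable_EFin_cst.
  have iabs : nu.-integrable setT (EFin \o (fun y => `|y|)).
    exact: integrable_norm (normal_id_integrable s_gt0).
  apply: le_trans (@Rintegral_norm_le _ _ _ nu (fun y => f (x + y) - f x) _ _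
    (l x) (integrable_EFinZ C iabs)) _.
    by apply: measurable_funB => //; exact: measurable_shift.
  by rewrite RintegralZl// ler_wpM2l// normal_abs_bound.
have -> : f (x + z) - gauss_avg f x = (f (x + z) - f x) - (gauss_avg f x - f x).
  by ring.
by rewrite (le_trans (ler_normB _ _))// mulrDr lerD.
Qed.

(** Both terms are expanded at [x]. The Gaussian step has mean 0 and variance s^2, so it contributes
    only s^2 / 2 times [f2 x] up to its third absolute moment. What is subtracted is linear in z and
    z^2 - s^2, which have mean zero for a centred weight of variance s^2. *)
Lemma gauss_avg_step3 C f f1 f2 x z : taylor_class C f f1 f2 ->
  `|f (x + z) - gauss_avg f x - z * f1 x - (z ^+ 2 - s ^+ 2) / 2 * f2 x| <=
    C * (`|z| ^+ 3 + 66 * s ^+ 3).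
Proof.
move=> [b b1 b2 l l1 l2 t].
have c := lipschitz_continuousR l.
have C0 : 0 <= C by rewrite (le_trans _ (b 0)).
have i x' := integrable_shift x' c b.
have ic := integrable_EFin_cst nu (f x).
have i1 := integrable_EFinZ (f1 x) (normal_id_integrable s_gt0).
have i2 := integrable_EFinZ (f2 x / 2) (normal_sq_integrable s_gt0).
have h : `|gauss_avg f x - f x - s ^+ 2 / 2 * f2 x| <= C * (66 * s ^+ 3).
  have -> : gauss_avg f x - f x - s ^+ 2 / 2 * f2 x =
      \int[nu]_y (f (x + y) - f x - f1 x * y - f2 x / 2 * y ^+ 2).
    have i' := integrable_EFinD (i x) (integrable_EFinN ic).
    rewrite RintegralB//; last first.
      exact: (integrable_EFinD i' (integrable_EFinN i1)).
    rewrite RintegralB// RintegralB// Rintegral_probability_cst.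
    rewrite RintegralZl ?(normal_id_integrable s_gt0)//.
    rewrite RintegralZl ?(normal_sq_integrable s_gt0)//.
    by rewrite normal_mean// normal_variance// mulr0 subr0; congr (_ - _); ring.
  have i3 := normal_cube_integrable s_gt0.
  apply: le_trans (Rintegral_norm_le _ _ (integrable_EFinZ C i3)) _.
  - have mT : @measurable_fun _ _ (measurableTypeR R) R setT id.
      exact: measurable_id.
    apply: measurable_funB; last by apply: measurable_funM => //; exact: measurable_funX.
    apply: measurable_funB; last by apply: measurable_funM.
    by apply: measurable_funB => //; exact: measurable_shift.
  - move=> y; apply: le_trans (t x y); rewrite le_eqVlt; apply/orP; left.
    by apply/eqP; congr (`|_|); ring.
  - by rewrite RintegralZl// ler_wpM2l// normal_cube_bound.
have -> : f (x + z) - gauss_avg f x - z * f1 x - (z ^+ 2 - s ^+ 2) / 2 * f2 x =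
  (f (x + z) - f x - z * f1 x - z ^+ 2 / 2 * f2 x) -
  (gauss_avg f x - f x - s ^+ 2 / 2 * f2 x) by ring.
by rewrite (le_trans (ler_normB _ _))// mulrDr lerD.
Qed.

(** Variances of successive convolutions add. With n steps of variance 1/n this yields the standard
    normal law exactly, with no error term. *)
Lemma iter_gauss_avg C f f1 f2 k c x : taylor_class C f f1 f2 ->
  (forall x, 0 <= f x) -> 0 < c -> c ^+ 2 = k.+1%:R * s ^+ 2 ->
  iter k.+1 gauss_avg f x = \int[normal_prob 0 c]_u f (x + u).
Proof.
move=> tc f0; have cf := lipschitz_continuousR (tc_lip tc).
elim: k c x => [|k IH] c x c0 cE.
  suff -> : c = s by [].
  by apply/eqP; rewrite -(eqrXn2 (ltn0Sn 1)) ?ltW// cE mul1r.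
pose c' := Num.sqrt k.+1%:R * s.
have c'0 : 0 < c' by rewrite mulr_gt0// sqrtr_gt0.
have c'E : c' ^+ 2 = k.+1%:R * s ^+ 2 by rewrite exprMn sqr_sqrtr.
rewrite iterS /gauss_avg -/gauss_avg.
under eq_Rintegral do rewrite (IH c')//.
rewrite /Rintegral -(@normal_prob_conv _ s c' c (fun u => f (x + u)))//; last 2 first.
- by rewrite cE c'E -natr1; ring.
- move=> y; apply: (cvg_comp (fun y => x + y) f); last exact: cf.
  by apply: (@cvgD _ R^o) => //; exact: cvg_cst.
congr fine; apply: eq_integral => y _; rewrite fineK.
  by apply: eq_integral => z _; rewrite addrA.
apply: integrable_fin_num => //.
apply: (@integrable_EFin_bounded _ _ _ _ _ C); first exact: measurable_shift.
by move=> z; exact: tc_bound tc _.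
Qed.

End gaussian_average.

(** * A cubic spline *)

Section cubic_spline.
Variable R : realType.
Implicit Types x y u : R.

Definition pospart x : R := if 0 <= x then x else 0.

(** The distribution function of the sum of three independent uniform variables on [0, 1]: a
    piecewise cubic function of class C^2 that rises from 0 to 1 on [0, 3]. [spline1] and [spline2]
    are its derivatives. *)
Definition spline x : R := (pospart x ^+ 3 - 3 * pospart (x - 1) ^+ 3 +
  3 * pospart (x - 2) ^+ 3 - pospart (x - 3) ^+ 3) / 6.

Definition spline1 x : R := (pospart x ^+ 2 - 3 * pospart (x - 1) ^+ 2 +
  3 * pospart (x - 2) ^+ 2 - pospart (x - 3) ^+ 2) / 2.

Definition spline2 x : R := pospart x - 3 * pospart (x - 1) +
  3 * pospart (x - 2) - pospart (x - 3).

Lemma pospart_cube_taylor x y :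
  `|pospart (x + y) ^+ 3 - pospart x ^+ 3 - 3 * y * pospart x ^+ 2 -
    3 * y ^+ 2 * pospart x| <= `|y| ^+ 3.
Proof.
rewrite /pospart; case: (leP 0 x) => x0; case: (leP 0 (x + y)) => xy0.
- have -> : (x + y) ^+ 3 - x ^+ 3 - 3 * y * x ^+ 2 - 3 * y ^+ 2 * x = y ^+ 3 by ring.
  by rewrite normrX.
- have y0 : y <= 0 by lra.
  rewrite (ler0_norm y0); set u := - y; have -> : y = - u by rewrite /u opprK.
  have ux : 0 <= u - x by rewrite /u; lra.
  rewrite (_ : _ - _ = - (u ^+ 3 - (u - x) ^+ 3)); last by ring.
  rewrite normrN ger0_norm ?subr_ge0 ?gerBl ?exprn_ge0//.
  by rewrite lerXn2r ?nnegrE ?(le_trans ux)//; lra.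
- have y0 : 0 <= y by lra.
  rewrite !expr0n/= !mulr0 !subr0 (ger0_norm y0) ger0_norm ?exprn_ge0//.
  by rewrite lerXn2r ?nnegrE//; lra.
- by rewrite !expr0n/= !mulr0 !subr0 normr0 exprn_ge0.
Qed.

Lemma pospart_sq_taylor x y :
  `|pospart (x + y) ^+ 2 - pospart x ^+ 2 - 2 * y * pospart x| <= y ^+ 2.
Proof.
rewrite /pospart; case: (leP 0 x) => x0; case: (leP 0 (x + y)) => xy0.
- have -> : (x + y) ^+ 2 - x ^+ 2 - 2 * y * x = y ^+ 2 by ring.
  by rewrite ger0_norm ?sqr_ge0.
- rewrite ler_norml !expr2; apply/andP; split; nra.
- rewrite ler_norml !expr2; apply/andP; split; nra.
- by rewrite !expr0n/= !mulr0 !subr0 normr0 sqr_ge0.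
Qed.

Lemma pospart_lip x y : `|pospart (x + y) - pospart x| <= `|y|.
Proof.
have := ler_norm y; have := ler_norm (- y); rewrite normrN => h1 h2.
by rewrite /pospart; case: (leP 0 (x + y)) => xy0; case: (leP 0 x) => x0;
  rewrite ler_norml; apply/andP; split; lra.
Qed.

Lemma spline_le0 x : x <= 0 -> spline x = 0.
Proof.
rewrite /spline /pospart => x0; case: (leP 0 x) => x1; case: (leP 0 (x - 1)) => x2; case: (leP 0 (x - 2)) => x3;
  case: (leP 0 (x - 3)) => x4; try lra; rewrite !expr0n/=; try lra.
have -> : x = 0 by apply/eqP; rewrite eq_le x0.
by rewrite !expr0n/=; lra.
Qed.

Lemma spline_ge3 x : 3 <= x -> spline x = 1.
Proof.
rewrite /spline /pospart => x0; case: (leP 0 x) => x1; case: (leP 0 (x - 1)) => x2; case: (leP 0 (x - 2)) => x3;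
  case: (leP 0 (x - 3)) => x4; try lra.
Qed.

Lemma unit_powers (t : R) : 0 <= t <= 1 ->
  [/\ 0 <= t ^+ 2, t ^+ 2 <= t, 0 <= t ^+ 3 & t ^+ 3 <= t ^+ 2].
Proof.
case/andP=> t0 t1; rewrite !exprn_ge0//; split => //.
  by rewrite expr2 ler_piMr.
by rewrite exprS ler_piMl ?exprn_ge0.
Qed.

Lemma spline_ge0_le1 x : 0 <= spline x <= 1.
Proof.
have [/spline_le0->|x0] := leP x 0; first by rewrite lexx ler01.
have [/spline_ge3->|x3] := leP 3 x; first by rewrite lexx ler01.
rewrite /spline /pospart (ltW x0); have -> : 0 <= x - 3 = false by apply/negbTE; lra.
case: (leP 0 (x - 1)) => x1; case: (leP 0 (x - 2)) => x2; rewrite ?expr0n/=; try lra.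
- have [|a b c d] := @unit_powers (3 - x); first by apply/andP; split; lra.
  by apply/andP; split; lra.
- have [|a b c d] := @unit_powers (x - 1); first by apply/andP; split; lra.
  have [|a' b' c' d'] := @unit_powers (2 - x); first by apply/andP; split; lra.
  by apply/andP; split; lra.
- have [|a b c d] := @unit_powers x; first by apply/andP; split; lra.
  by apply/andP; split; lra.
Qed.

(** The difference is the density of a sum of four uniform variables, that is, the cubic B-spline on
    [0, 4]. Nonnegativity is checked on each polynomial piece, in a variable running over [0, 1]. *)
Lemma spline_diff_ge0 x : 0 <= spline x - spline (x - 1).
Proof.
have [x0|x0] := leP x 0; first by rewrite !spline_le0 ?subrr//; lra.
have [x4|x4] := leP 3 x.
  by rewrite (spline_ge3 x4) subr_ge0; case/andP: (spline_ge0_le1 (x - 1)).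
rewrite /spline /pospart (ltW x0).
have -> : 0 <= x - 3 = false by apply/negbTE; lra.
have -> : 0 <= x - 1 - 2 = false by apply/negbTE; lra.
have -> : 0 <= x - 1 - 3 = false by apply/negbTE; lra.
have -> : x - 1 - 1 = x - 2 by ring.
case: (leP 0 (x - 1)) => x1; case: (leP 0 (x - 2)) => x2; rewrite ?expr0n/=; try lra.
- have [|a b c d] := @unit_powers (3 - x); first by apply/andP; split; lra.
  by lra.
- have [|a b c d] := @unit_powers (x - 1); first by apply/andP; split; lra.
  by lra.
- have [|a b c d] := @unit_powers x; first by apply/andP; split; lra.
  by lra.
Qed.

Lemma spline1_bound x : `|spline1 x| <= 1.
Proof.
rewrite /spline1 /pospart ler_norml.
by case: (leP 0 x) => x1; case: (leP 0 (x - 1)) => x2; case: (leP 0 (x - 2)) => x3;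
  case: (leP 0 (x - 3)) => x4;
  rewrite !expr2; apply/andP; split; nra.
Qed.

Lemma spline2_bound x : `|spline2 x| <= 3.
Proof.
rewrite /spline2 /pospart ler_norml.
by case: (leP 0 x) => x1; case: (leP 0 (x - 1)) => x2; case: (leP 0 (x - 2)) => x3;
  case: (leP 0 (x - 3)) => x4;
  apply/andP; split; lra.
Qed.

(** The remainders of the four truncated cubes add up with weights 1 + 3 + 3 + 1 = 8, divided by
    6. *)
Lemma spline_taylor x y :
  `|spline (x + y) - spline x - y * spline1 x - y ^+ 2 / 2 * spline2 x| <=
    8 / 6 * `|y| ^+ 3.
Proof.
have := pospart_cube_taylor x y; have := pospart_cube_taylor (x - 1) y.
have := pospart_cube_taylor (x - 2) y; have := pospart_cube_taylor (x - 3) y.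
rewrite /spline /spline1 /spline2 -![x - _ + y]addrAC.
rewrite !ler_norml => /andP[a1 a2] /andP[b1 b2] /andP[c1 c2] /andP[d1 d2].
by apply/andP; split; lra.
Qed.

Lemma spline1_taylor x y : `|spline1 (x + y) - spline1 x - y * spline2 x| <= 4 * y ^+ 2.
Proof.
have := pospart_sq_taylor x y; have := pospart_sq_taylor (x - 1) y.
have := pospart_sq_taylor (x - 2) y; have := pospart_sq_taylor (x - 3) y.
rewrite /spline1 /spline2 -![x - _ + y]addrAC.
rewrite !ler_norml => /andP[a1 a2] /andP[b1 b2] /andP[c1 c2] /andP[d1 d2].
by apply/andP; split; lra.
Qed.

(** The constant 8 = 1 + 3 + 3 + 1 is the Lipschitz bound for [spline2]; the other conditions hold
    with smaller constants. *)
Lemma spline_taylor_class : taylor_class 8 spline spline1 spline2.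
Proof.
have b0 x : `|spline x| <= 1.
  by case/andP: (spline_ge0_le1 x) => a b; rewrite ger0_norm.
split.
- by move=> x; have := b0 x; lra.
- by move=> x; have := spline1_bound x; lra.
- by move=> x; have := spline2_bound x; lra.
(* For |y| > 1 the bound on the values is enough; for |y| <= 1 all powers of |y| in the Taylor
   expansion are at most |y|. *)
- move=> x y; have [y1|y1] := leP `|y| 1; last first.
    have := ler_normB (spline (x + y)) (spline x).
    by have := b0 x; have := b0 (x + y); lra.
  have -> : spline (x + y) - spline x = (spline (x + y) - spline x - y * spline1 x -
    y ^+ 2 / 2 * spline2 x) + y * spline1 x + y ^+ 2 / 2 * spline2 x by ring.
  apply: le_trans (ler_normD _ _) _; apply: le_trans (lerD (ler_normD _ _) (lexx _)) _.
  have := spline_taylor x y; rewrite (normrM y) !(normrM (y ^+ 2 / 2)) (normrM (y ^+ 2)) normrX normfV normr_nat => h.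
  have h1 := spline1_bound x; have h2 := spline2_bound x.
  have y0 : 0 <= `|y| by [].
  have i1 : `|y| * `|spline1 x| <= `|y| by rewrite ler_piMr.
  have y2 : `|y| ^+ 2 <= `|y| by rewrite expr2 ler_piMr.
  have y3 : `|y| ^+ 3 <= `|y| by rewrite exprS ler_piMr// exprn_ile1.
  have i2 : `|y| ^+ 2 / 2 * `|spline2 x| <= `|y| / 2 * 3.
    by rewrite ler_pM ?divr_ge0 ?exprn_ge0// ler_pM2r ?invr_gt0.
  by lra.
- move=> x y; have [y1|y1] := leP `|y| 1; last first.
    have := ler_normB (spline1 (x + y)) (spline1 x).
    by have := spline1_bound x; have := spline1_bound (x + y); lra.
  have -> : spline1 (x + y) - spline1 x = (spline1 (x + y) - spline1 x - y * spline2 x) +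
    y * spline2 x by ring.
  apply: le_trans (ler_normD _ _) _.
  have := spline1_taylor x y; rewrite normrM -[y ^+ 2]real_normK ?num_real// => h.
  have h2 := spline2_bound x.
  have y0 : 0 <= `|y| by [].
  have y2 : `|y| ^+ 2 <= `|y| by rewrite expr2 ler_piMr.
  have i2 : `|y| * `|spline2 x| <= `|y| * 3 by rewrite ler_wpM2l.
  by lra.
- move=> x y; have := pospart_lip x y; have := pospart_lip (x - 1) y.
  have := pospart_lip (x - 2) y; have := pospart_lip (x - 3) y.
  rewrite /spline2 -![x - _ + y]addrAC.
  rewrite !ler_norml => /andP[a1 a2] /andP[b1 b2] /andP[c1 c2] /andP[d1 d2].
  by apply/andP; split; lra.
- move=> x y; apply: le_trans (spline_taylor x y) _.
  by rewrite ler_wpM2r ?exprn_ge0//; lra.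
Qed.

End cubic_spline.

(** The third-order remainder scales by a^3; since [a] is at least 1, this factor also covers the
    lower powers of [a] in the other conditions. *)
Lemma taylor_class_affine (R : realType) (C a b : R) f f1 f2 : 1 <= a ->
  taylor_class C f f1 f2 ->
  taylor_class (C * a ^+ 3) (fun x => f (a * x - b)) (fun x => a * f1 (a * x - b))
    (fun x => a ^+ 2 * f2 (a * x - b)).
Proof.
move=> a1 [h0 h1 h2 l0 l1 l2 t].
have a0 : 0 <= a by lra.
have C0 : 0 <= C by rewrite (le_trans _ (h0 0)).
have e x y : a * (x + y) - b = (a * x - b) + a * y by ring.
have Ca i : (i <= 3)%N -> C * a ^+ i <= C * a ^+ 3.
  by move=> i3; rewrite ler_wpM2l// ler_weXn2l.
split=> [x|x|x|x y|x y|x y|x y].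
- by apply: le_trans (h0 _) _; have := Ca 0%N isT; rewrite expr0 mulr1.
- rewrite normrM (ger0_norm a0) (le_trans _ (Ca 1%N isT))// mulrC ler_wpM2r//.
- rewrite normrM normrX (ger0_norm a0) (le_trans _ (Ca 2%N isT))// mulrC.
  by rewrite ler_wpM2r// exprn_ge0.
- rewrite e; apply: le_trans (l0 _ _) _; rewrite normrM (ger0_norm a0) mulrA.
  by rewrite ler_wpM2r// (Ca 1%N).
- rewrite e -mulrBr normrM (ger0_norm a0).
  apply: le_trans (ler_wpM2l a0 (l1 _ _)) _; rewrite normrM (ger0_norm a0).
  rewrite (_ : a * _ = C * a ^+ 2 * `|y|); last by ring.
  by rewrite ler_wpM2r// (Ca 2%N).
- rewrite e -mulrBr normrM normrX (ger0_norm a0).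
  apply: le_trans (ler_wpM2l (exprn_ge0 2 a0) (l2 _ _)) _; rewrite normrM (ger0_norm a0).
  by rewrite le_eqVlt; apply/orP; left; apply/eqP; ring.
- rewrite e; have := t (a * x - b) (a * y); rewrite normrM exprMn (ger0_norm a0).
  rewrite exprMn mulrA; congr (`|_| <= _); ring.
Qed.

(** * Weak convergence from spline test functions *)

Lemma continuous_unif_segment (R : realType) (f : R -> R) (a b e : R) :
  continuous f -> 0 < e ->
  exists2 r, 0 < r & forall x y, a <= x <= b -> `|y - x| < r -> `|f x - f y| <= e.
Proof.
move=> cf e0.
have /compact_near_coveringP := @segment_compact R a b.
pose P (r x : R) := forall y, `|y - x| < r -> `|f x - f y| <= e.
move=> /(_ R (0 : R)^'+ P _) => H.
have : \forall r \near (0 : R)^'+, `[a, b] `<=` P r.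
  apply: H => x _.
  have /cvgrPdist_le /(_ (e / 2)) := cf x.
  rewrite divr_gt0// => /(_ isT) /nbhs_ballP[r /= r0 rP].
  have r20 : 0 < r / 2 by rewrite divr_gt0.
  exists (ball x (r / 2), [set s | s < r / 2]); first split => /=.
  - exact: nbhsx_ballx.
  - exact: nbhs_right_lt.
  move=> [x' s] /= [xx' sr] y ys.
  have h1 : `|f x - f x'| <= e / 2.
    by apply: rP; rewrite /ball/= in xx' *; lra.
  have h2 : `|f x - f y| <= e / 2.
    apply: rP; rewrite /ball/= in xx' *; rewrite distrC.
    rewrite (_ : y - x = (y - x') - (x - x')); last by ring.
    by apply: le_lt_trans (ler_normB _ _) _; lra.
  rewrite (_ : f x' - f y = (f x - f y) - (f x - f x')); last by ring.
  by apply: le_trans (ler_normB _ _) _; lra.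
move=> near_r; have [r [rP r0]] : exists r, (`[a, b] `<=` P r) /\ 0 < r.
  apply: (@filter_ex _ (0 : R)^'+); near=> r; split; near: r => //.
  exact: nbhs_right_gt.
exists r => // x y xab; apply: rP; by rewrite /= in_itv.
Unshelve. all: by end_near. Qed.

Definition spline_family (R : realType) (j : nat) (k : int) (x : R) : R :=
  spline (j.+1%:R * x - k%:~R).

Section spline_approximation.
Variables (R : realType) (f : R -> R) (B e : R) (A j : nat).
Hypothesis fB : forall x, `|f x| <= B.
Hypothesis fj : forall x y, - A%:R <= x <= A%:R + 4 ->
  `|y - x| < 4 / j.+1%:R -> `|f x - f y| <= e.

(** The nodes [k i / j.+1] run through a grid of mesh [1 / j.+1], from -A at i = 0 to A at i = N. *)
Let N := (A * j.+1 + A * j.+1)%N.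
Let k (i : nat) : int := i%:Z - (A * j.+1)%:Z.

(* The differences of consecutive shifts of the spline are nonnegative bumps summing to
   spline_cutoff, a smoothed indicator of [-A, A]. *)
Definition spline_interpolant (x : R) : R :=
  \sum_(i < N) f ((k i)%:~R / j.+1%:R) *
    (spline_family j (k i) x - spline_family j (k i.+1) x).

Definition spline_cutoff (x : R) : R :=
  spline_family j (k 0%N) x - spline_family j (k N) x.

Let bump_ge0 i (x : R) : 0 <= spline_family j (k i) x - spline_family j (k i.+1) x.
Proof.
rewrite /spline_family.
have -> : (k i.+1)%:~R = (k i)%:~R + 1 :> R by rewrite /k -addn1 PoszD addrAC rmorphD.
by rewrite opprD addrA spline_diff_ge0.
Qed.

Let cutoffE x : spline_cutoff x =
  \sum_(i < N) (spline_family j (k i) x - spline_family j (k i.+1) x).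
Proof.
rewrite -(big_mkord xpredT
  (fun i => spline_family j (k i) x - spline_family j (k i.+1) x)).
have := @telescope_sumr R 0 N (fun i => - spline_family j (k i) x) (leq0n _).
rewrite opprK addrC /spline_cutoff => <-.
by apply: eq_bigr => i _; rewrite opprK addrC.
Qed.

(** [f x] is distributed over the bumps. A bump is nonzero at [x] only if [x] lies within [4 / j.+1]
    to the right of its node, and there [f] changes by at most [e]. The bumps have total mass
    [spline_cutoff x]; the missing mass is charged at the bound [B]. *)
Lemma spline_interpolant_error x :
  `|f x - spline_interpolant x| <= `|e| + B * (1 - spline_cutoff x).
Proof.
have cut1 : spline_cutoff x <= 1.
  rewrite /spline_cutoff.
  have /andP[_] := spline_ge0_le1 (j.+1%:R * x - (k 0%N)%:~R).
  have /andP[+ _] := spline_ge0_le1 (j.+1%:R * x - (k N)%:~R).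
  by rewrite /spline_family; lra.
have cut0 : 0 <= spline_cutoff x by rewrite cutoffE sumr_ge0.
have -> : f x - spline_interpolant x = f x * (1 - spline_cutoff x) +
  \sum_(i < N) (f x - f ((k i)%:~R / j.+1%:R)) *
    (spline_family j (k i) x - spline_family j (k i.+1) x).
  under eq_bigr do rewrite mulrBl.
  by rewrite sumrB -mulr_sumr -cutoffE /spline_interpolant; ring.
apply: le_trans (ler_normD _ _) _; rewrite addrC lerD//; last first.
  by rewrite normrM (ger0_norm (_ : 0 <= 1 - _)) ?subr_ge0// ler_wpM2r// subr_ge0.
apply: (@le_trans _ _ (`|e| * spline_cutoff x)); last by rewrite ler_piMr.
rewrite cutoffE mulr_sumr; apply: le_trans (ler_norm_sum _ _ _) _.
apply: ler_sum => i _; rewrite normrM (ger0_norm (bump_ge0 _ _)).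
have j0 : 0 < j.+1%:R :> R by [].
have kS : (k i.+1)%:~R = (k i)%:~R + 1 :> R by rewrite /k -addn1 PoszD addrAC rmorphD.
have [xk|xk] := leP (j.+1%:R * x - (k i)%:~R) 0.
  have -> : spline_family j (k i) x - spline_family j (k i.+1) x = 0; last by rewrite !mulr0.
  rewrite /spline_family spline_le0// spline_le0 ?subrr// kS; lra.
have [xk'|xk'] := leP 4 (j.+1%:R * x - (k i)%:~R).
  have -> : spline_family j (k i) x - spline_family j (k i.+1) x = 0; last by rewrite !mulr0.
  rewrite /spline_family spline_ge3 ?spline_ge3 ?subrr// ?kS; lra.
rewrite ler_wpM2r//; apply: le_trans (ler_norm e); apply: fj.
- have kE : (k i)%:~R = i%:R - A%:R * j.+1%:R :> R.
    by rewrite /k rmorphB/= -!pmulrn natrM.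
  have ki1 : - (A%:R * j.+1%:R) <= (k i)%:~R :> R.
    by rewrite kE lerBrDr addNr.
  have ki2 : (k i)%:~R <= A%:R * j.+1%:R :> R.
    by rewrite kE lerBlDr -natrM -natrD ler_nat ltnW.
  have xA : - A%:R * j.+1%:R <= x * j.+1%:R by lra.
  have xA' : x * j.+1%:R <= (A%:R + 4) * j.+1%:R.
    have j1 : 1 <= j.+1%:R :> R by rewrite ler1n.
    by lra.
  by rewrite -(ler_pM2r j0) xA -(ler_pM2r j0).
- rewrite distrC; have -> : x - (k i)%:~R / j.+1%:R = (j.+1%:R * x - (k i)%:~R) / j.+1%:R.
    by field; rewrite gt_eqF.
  by rewrite ger0_norm ?divr_ge0 ?ltW// ltr_pM2r ?invr_gt0.
Qed.

Lemma spline_family_cts i : continuous (spline_family j i : R -> R).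
Proof.
have j1 : 1 <= j.+1%:R :> R by rewrite ler1n.
exact: lipschitz_continuousR (tc_lip (taylor_class_affine i%:~R j1 (@spline_taylor_class R))).
Qed.

Lemma spline_family_bound i (x : R) : `|spline_family j i x| <= 1.
Proof.
by have /andP[h0 h1] := spline_ge0_le1 (j.+1%:R * x - i%:~R); rewrite ger0_norm.
Qed.

(** Approximation and error involve the law of [X] only through the numbers [I], the loss of mass at
    infinity included. Hence laws with nearby values of [I] have nearby integrals of [f]. *)
Lemma spline_interpolant_integral d (T : measurableType d) (P : probability T R)
    (X : T -> R) (I : int -> R) :
  (forall i, \int[P]_x spline_family j i (X x) = I i) ->
  measurable_fun setT X -> measurable_fun setT f ->
  `|\int[P]_x f (X x) - \sum_(i < N) f ((k i)%:~R / j.+1%:R) * (I (k i) - I (k i.+1))| <=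
  `|e| + B * (1 - (I (k 0%N) - I (k N))).
Proof.
move=> IE mX mf.
have mS i : measurable_fun setT (fun x => spline_family j i (X x)).
  by apply: measurableT_comp => //; apply: continuous_measurable_fun; exact: spline_family_cts.
have iS i : P.-integrable setT (EFin \o (fun x => spline_family j i (X x))).
  by apply: (@integrable_EFin_bounded _ _ _ P _ 1 (mS i)) => x; exact: spline_family_bound.
have iD i i' : P.-integrable setT
    (EFin \o (fun x => spline_family j i (X x) - spline_family j i' (X x))).
  exact: (integrable_EFinD (iS _) (integrable_EFinN (iS _))).
have iC : P.-integrable setT (EFin \o (fun x => 1 - spline_cutoff (X x))).
  exact: (integrable_EFinD (integrable_EFin_cst P 1) (integrable_EFinN (iD _ _))).
have iZ i := integrable_EFinZ (f ((k i)%:~R / j.+1%:R)) (iD (k i) (k i.+1)).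
have ig : P.-integrable setT (EFin \o (fun x => spline_interpolant (X x))).
  exact: (integrable_EFin_sum _ (fun i => iZ (nat_of_ord i))).
have -> : \sum_(i < N) f ((k i)%:~R / j.+1%:R) * (I (k i) - I (k i.+1)) =
    \int[P]_x spline_interpolant (X x).
  rewrite /spline_interpolant (Rintegral_sum _ (fun i => iZ (nat_of_ord i))).
  by apply: eq_bigr => i _; rewrite RintegralZl// RintegralB// !IE.
have if_ : P.-integrable setT (EFin \o (fun x => f (X x))).
  by apply: (@integrable_EFin_bounded _ _ _ _ _ B) => //; exact: measurableT_comp.
rewrite -RintegralB// -!IE -RintegralB//.
rewrite -[X in _ + B * (X - _)](Rintegral_probability_cst P) -RintegralB//; last first.
  exact: integrable_EFin_cst.
rewrite -RintegralZl//.
rewrite -[X in X + _](Rintegral_probability_cst P) -RintegralD//; last 2 first.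
  exact: integrable_EFin_cst.
  exact: integrable_EFinZ.
apply: Rintegral_norm_le.
- by apply: measurable_funB; [exact: measurableT_comp|exact/measurable_EFinP/(measurable_int P ig)].
- by move=> x; exact: spline_interpolant_error.
- exact: (integrable_EFinD (integrable_EFin_cst P _) (integrable_EFinZ _ iC)).
Qed.

(** Chebyshev's bound: the ramps have length at most 3, so the cutoff is 1 for |x| <= A - 3, and for
    larger |x| the left side is not positive. *)
Lemma spline_cutoff_ge (x : R) : (3 < A)%N -> 1 - x ^+ 2 / (A%:R - 3) ^+ 2 <= spline_cutoff x.
Proof.
move=> A3; have A3' : 0 < A%:R - 3 :> R by rewrite subr_gt0 ltr_nat.
have j1 : 1 <= j.+1%:R :> R by rewrite ler1n.
have k0E : (k 0%N)%:~R = - (A%:R * j.+1%:R) :> R.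
  by rewrite /k rmorphB/= -!pmulrn natrM sub0r.
have kNE : (k N)%:~R = A%:R * j.+1%:R :> R.
  by rewrite /k /N rmorphB/= -!pmulrn natrD natrM addrK.
rewrite /spline_cutoff /spline_family k0E kNE.
have [xA|xA] := leP `|x| (A%:R - 3).
  move: xA; rewrite ler_norml => /andP[x1 x2].
  rewrite spline_ge3; last by nra.
  rewrite spline_le0; last by nra.
  by rewrite subr0 gerBl divr_ge0 ?sqr_ge0.
apply: (@le_trans _ _ 0).
  rewrite subr_le0 ler_pdivlMr ?exprn_gt0// mul1r -[leRHS]real_normK ?num_real//.
  by rewrite lerXn2r ?nnegrE// ltW.
have [x0|x0] := leP 0 x.
  rewrite spline_ge3; last by nra.
  by have /andP[] := spline_ge0_le1 (j.+1%:R * x - A%:R * j.+1%:R); lra.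
rewrite (@spline_le0 _ (j.+1%:R * x - A%:R * j.+1%:R)); last by nra.
by rewrite subr0; have /andP[] := spline_ge0_le1 (j.+1%:R * x - - (A%:R * j.+1%:R)).
Qed.

End spline_approximation.

(** Tightness of the laws [mu n] is not assumed but derived: the cutoff is itself a difference of
    two members of the family, so its integral converges, and for the Gaussian limit it is close to
    1 by Chebyshev's bound. *)
Lemma spline_weak_cvg (R : realType) (mu : nat -> probability R R) :
  (forall j i, \int[mu n]_x spline_family j i x @[n --> \oo] -->
     \int[normal_prob (0 : R) 1]_x spline_family j i x) ->
  weak_cvg mu (normal_prob 0 1).
Proof.
move=> H f cf bf.
have [B fB] : exists B : R, forall x, `|f x| <= B.
  by have [M [_ /(_ (M + 1))]] := bf; rewrite ltrDl ltr01 => /(_ isT) fM; exists (M + 1) => x; exact: fM.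
have B0 : 0 <= B by rewrite (le_trans _ (fB 0)).
have mf : measurable_fun [set: R] f by exact: continuous_measurable_fun.
have intf n : (mu n).-integrable setT (EFin \o f) by exact: integrable_EFin_bounded fB.
have intg : (normal_prob 0 1).-integrable setT (EFin \o f).
  by apply: (@integrable_EFin_bounded _ _ _ _ _ B) => //; exact: mf.
rewrite -EFin_Rintegral//; apply: cvg_EFin.
  by near=> n; exact: integrable_fin_num (intf n).
apply/cvgrPdist_le => e e0; rewrite /=.
(* The errors at the end add up to 3 e' + 4 B e', which is below 6 (1 + B) e' = e. *)
pose e' := e / (6 * (1 + B)).
have B6 : 0 < 6 * (1 + B) by lra.
have e'0 : 0 < e' by rewrite divr_gt0.
have e'E : e = 6 * e' + 6 * (B * e') by rewrite /e'; field; lra.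
have [A A3 Ae] : exists2 A, (3 < A)%N & ((A%:R - 3) ^+ 2)^-1 <= e'.
  pose m := (truncn (e'^-1)).+1; exists (m + 3)%N; first by rewrite /m; lia.
  have m1 : e'^-1 < m%:R by rewrite /m; exact: truncnS_gt.
  rewrite natrD addrK -[leRHS]invrK lef_pV2 ?posrE ?invr_gt0 ?exprn_gt0//.
  rewrite (le_trans (ltW m1))// -[leLHS]mulr1 expr2 ler_wpM2l// ler1n //.
have [r r0 fr] := continuous_unif_segment (- A%:R) (A%:R + 4) cf e'0.
pose j := truncn (4 / r).
have jr : 4 / j.+1%:R < r.
  rewrite ltr_pdivrMr// mulrC -ltr_pdivrMr//; exact: truncnS_gt.
have fj x y : - A%:R <= x <= A%:R + 4 -> `|y - x| < 4 / j.+1%:R -> `|f x - f y| <= e'.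
  by move=> xA xy; apply: fr => //; exact: lt_trans jr.
pose I n i := \int[mu n]_x spline_family j i x.
pose J i := \int[normal_prob (0 : R) 1]_x spline_family j i x.
have errI n := spline_interpolant_integral fB fj
  (fun i => erefl (I n i)) (@measurable_id _ _ setT) mf.
have errJ := spline_interpolant_integral fB fj
  (fun i => erefl (J i)) (@measurable_id _ _ setT) mf.
rewrite (gtr0_norm e'0) in errI errJ.
set k0 := 0%:Z - _ in errI errJ; set kN := (_ + _)%N%:Z - _ in errI errJ.
set SJ := \sum_(i < _) _ in errJ.
set SI := fun n => \sum_(i < (A * j.+1 + A * j.+1)) 
    f ((i%:Z - (A * j.+1)%:Z)%:~R / j.+1%:R) *
    (I n (i%:Z - (A * j.+1)%:Z) - I n (i.+1%:Z - (A * j.+1)%:Z)).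
have cI i : I n i @[n --> \oo] --> J i by exact: H.
have cS : SI n @[n --> \oo] --> SJ.
  apply: cvg_big => [|i _]; first exact: add_continuous.
  by apply: cvgM; [exact: cvg_cst|apply: cvgB].
have cutJ : 1 - e' <= J k0 - J kN.
  have iq := integrable_EFinZ (- ((A%:R - 3) ^+ 2)^-1) (normal_sq_integrable (@ltr01 R)).
  have iS i : (normal_prob (0 : R) 1).-integrable setT (EFin \o spline_family j i).
    apply: (@integrable_EFin_bounded _ _ _ _ _ 1).
      by apply: continuous_measurable_fun; exact: spline_family_cts.
    by move=> x; exact: spline_family_bound.
  have i1 := integrable_EFin_cst (normal_prob (0 : R) 1) 1.
  rewrite -RintegralB//; apply: (@le_trans _ _ (\int[normal_prob (0 : R) 1]_x
      (1 + - ((A%:R - 3) ^+ 2)^-1 * x ^+ 2))).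
    rewrite RintegralD// RintegralZl ?(normal_sq_integrable (@ltr01 R))//.
    by rewrite Rintegral_probability_cst normal_variance// expr1n mulr1 lerD2l lerN2.
  apply: RintegralT_le.
  - exact: integrable_EFinD.
  - exact: (integrable_EFinD (iS _) (integrable_EFinN (iS _))).
  - by move=> x; have := spline_cutoff_ge j x A3; rewrite mulNr mulrC.
near=> n.
have d0 : `|J k0 - I n k0| <= e' by near: n; move/cvgrPdist_le : (cI k0); apply.
have dN : `|J kN - I n kN| <= e' by near: n; move/cvgrPdist_le : (cI kN); apply.
have dS : `|SJ - SI n| <= e' by near: n; move/cvgrPdist_le : (cS); apply.
have {errI} := errI n; rewrite -/(SI n) -/k0 -/kN => errI.
(* Up to e' the mass is lost in the limit, and the two convergent integrals differ from their limits
   by e' each. *)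
have cutI : 1 - (I n k0 - I n kN) <= 3 * e'.
  by move: d0 dN; rewrite !ler_norml => /andP[? ?] /andP[? ?]; lra.
have b1 : B * (1 - (I n k0 - I n kN)) <= B * (3 * e') by rewrite ler_wpM2l.
have b2 : B * (1 - (J k0 - J kN)) <= B * e' by rewrite ler_wpM2l//; lra.
have b3 : 0 <= B * e' by rewrite mulr_ge0// ltW.
rewrite -/(Rintegral (mu n) setT f).
move: errI errJ dS; rewrite !ler_norml => /andP[? ?] /andP[? ?] /andP[? ?].
by apply/andP; split; lra.
Unshelve. all: by end_near. Qed.

(** * Independence and the eighth moment *)

Section independent_product.
Context d (Omega : measurableType d) (R : realType) (P : probability Omega R).

(** Independence on rectangles identifies the joint law with the product of the laws, and Fubini's
    theorem applies there. [Z] is bounded, so integrability of [W] makes the product integrable. *)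
Lemma Rintegral_mul_indep (Z W : Omega -> R) (c : R) :
  measurable_fun setT Z -> measurable_fun setT W ->
  (forall A B : set R, measurable A -> measurable B ->
    P (Z @^-1` A `&` W @^-1` B) = (P (Z @^-1` A) * P (W @^-1` B))%E) ->
  (forall x, `|Z x| <= c) -> P.-integrable setT (EFin \o W) ->
  \int[P]_x (Z x * W x) = (\int[P]_x Z x) * \int[P]_x W x.
Proof.
move=> mZ mW ind Zc iW.
have iZ := integrable_EFin_bounded P mZ Zc.
have mZW : measurable_fun setT (fun x => (Z x, W x)) by exact: measurable_fun_pair.
pose Zm : {RV P >-> R} := mfun_Sub (mem_set mZ).
pose Wm : {RV P >-> R} := mfun_Sub (mem_set mW).
pose ZWm : {RV P >-> (R * R)%type} := mfun_Sub (mem_set mZW).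
have iZW : P.-integrable setT (EFin \o (fun x => Z x * W x)).
  apply: (le_integrable_EFin _ _ (integrable_EFinZ c (integrable_norm iW))).
    exact: measurable_funM.
  by move=> x; rewrite /= normrM ler_wpM2r.
pose g (z : R * R) : \bar R := (z.1 * z.2)%:E.
have mg : measurable_fun [set: R * R] g.
  by apply/measurable_EFinP; apply: measurable_funM.
have pE A : measurable A ->
    (distribution P Zm \x distribution P Wm)%E A = distribution P ZWm A.
  by apply: product_measure_unique => B C mB mC; rewrite -ind.
have ig : (distribution P ZWm).-integrable setT g.
  by apply: integrable_pushforward => //; exact: mZW.
have EJ : (\int[distribution P ZWm]_z g z = \int[P]_x (Z x * W x)%:E)%E.
  by rewrite integral_pushforward//; exact: mZW.
have ig' : (distribution P Zm \x distribution P Wm)%E.-integrable setT g.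
  move/integrableP : ig => [_ h]; apply/integrableP; split => //.
  by rewrite (eq_measure_integral (distribution P ZWm))// => A mA _; exact: pE.
rewrite {1}/Rintegral -EJ (eq_measure_integral (distribution P Zm \x distribution P Wm)%E); last first.
  by move=> A mA _; exact: esym (pE A mA).
rewrite /Rintegral -integral12_prod_meas1//.
have iWd : (distribution P Wm).-integrable setT (EFin \o id).
  by apply: integrable_pushforward => //; exact/measurable_EFinP/measurable_id.
have iZd : (distribution P Zm).-integrable setT (EFin \o id).
  by apply: integrable_pushforward => //; exact/measurable_EFinP/measurable_id.
have EW : (\int[distribution P Wm]_y y%:E = (\int[P]_x W x)%:E)%E.
  by rewrite EFin_Rintegral// integral_pushforward//; exact/measurable_EFinP/measurable_id.
have EZ : (\int[distribution P Zm]_y y%:E = (\int[P]_x Z x)%:E)%E.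
  by rewrite EFin_Rintegral// integral_pushforward//; exact/measurable_EFinP/measurable_id.
transitivity (fine (\int[distribution P Zm]_x (x%:E * (\int[P]_x W x)%:E))%E).
  congr fine; apply: eq_integral => z _; rewrite -EW -integralZl//.
by rewrite integralZr// EZ -EFinM.
Qed.

End independent_product.

Section independence.
Context d (Omega : measurableType d) (R : realType) (P : probability Omega R).
Variables (I : choiceType) (D : set I) (X : I -> {RV P >-> R}).
Hypothesis Xind : mutually_independent D X.

(** These finite intersections are the sets to which [mutually_independent] applies directly. They
    form a pi-system that generates the sigma-algebra of the variables indexed by [V]. *)
Definition cylinders (V : {fset I}) : set (set Omega) :=
  [set A | exists2 B : I -> set R, (forall i, measurable (B i)) &
    A = \bigcap_(i in [set` V]) X i @^-1` B i].

Definition adapted (V : {fset I}) (Z : Omega -> R) : Prop :=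
  @measurable_fun _ _ (g_sigma_algebraType (cylinders V)) R setT Z.

Lemma measurable_preimage_rv i (B : set R) : measurable B -> measurable (X i @^-1` B).
Proof. by move=> mB; rewrite -[_ @^-1` _]setTI; exact: measurable_funP. Qed.

Lemma cylinders_measurable V : cylinders V `<=` measurable.
Proof.
move=> A [B mB ->]; apply: fin_bigcap_measurable => // i _.
exact: measurable_preimage_rv.
Qed.

Lemma cylinders_setI V : setI_closed (cylinders V).
Proof.
move=> _ _ [A mA ->] [B mB ->]; exists (fun i => A i `&` B i).
  by move=> i; exact: measurableI.
by rewrite -bigcapI; apply: eq_bigcapr => i _; rewrite preimage_setI.
Qed.

Lemma cylinders_setT V : cylinders V setT.
Proof.
exists (fun=> setT) => //; apply/esym; rewrite -subTset => x _ i _ //.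
Qed.

Lemma cylinders_indep (V : {fset I}) u (A : set Omega) (C : set R) :
  [set` V] `<=` D -> D u -> u \notin V -> measurable C ->
  <<s cylinders V >> A ->
  P (A `&` X u @^-1` C) = (P A * P (X u @^-1` C))%E.
Proof.
move=> VD Du uV mC sA.
have mXC := measurable_preimage_rv u mC.
have r0 : 0 <= fine (P (X u @^-1` C)) by rewrite fine_ge0.
pose r : {nonneg R} := NngNum r0.
have rE A' : (mscale r P A' = P A' * P (X u @^-1` C))%E.
  by rewrite /mscale/= fineK ?fin_num_measure// muleC.
rewrite -rE.
apply: (@g_sigma_algebra_measure_unique _ _ _ (cylinders V) _ (fun=> setT) _ _
  (mrestr P mXC) (mscale r P)) sA.
- exact: cylinders_measurable.
- by move=> _; exact: cylinders_setT.
- by rewrite bigcup_const//; exists 0%N.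
- exact: cylinders_setI.
- move=> _ [B mB ->].
  transitivity (P (\bigcap_(i in [set` V]) X i @^-1` B i) * P (X u @^-1` C))%E; last first.
    exact: esym (rE _).
  rewrite /mrestr.
  (* A cylinder over [V] intersected with the event at [u] is a cylinder over [V] with [u] added. *)
  pose B' i := if i == u then C else B i.
  have mB' i : measurable (B' i) by rewrite /B'; case: ifP.
  have uVD : [set` (u |` V)%fset] `<=` D.
    by move=> i /=; rewrite !inE => /orP[/eqP->//|iV]; exact: VD.
  have B'E i : i \in V -> B' i = B i.
    by move=> iV; rewrite /B'; case: eqP iV => // ->; rewrite (negbTE uV).
  have B'u : B' u = C by rewrite /B' eqxx.
  have := Xind uVD mB'; rewrite big_fsetU1//= B'u.
  rewrite (eq_big_seq (fun i => P (X i @^-1` B i))); last by move=> i iV; rewrite B'E.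
  rewrite muleC -(Xind VD mB) => <-; congr (P _); apply/seteqP; split => x.
    move=> [xV xu] i /=; rewrite !inE => /orP[/eqP->|iV]; first by rewrite B'u.
    by rewrite B'E//; exact: xV.
  move=> xV; split.
    by move=> i /= iV; have := xV i; rewrite /= B'E// !inE iV orbT; exact.
  by have := xV u; rewrite /= B'u !inE eqxx; exact.
- move=> _; rewrite /mrestr; apply: le_lt_trans (probability_le1 P _) (ltry _).
  exact: measurableI.
Qed.

Lemma adapted_rv (V : {fset I}) i : i \in V -> adapted V (X i).
Proof.
move=> iV _ B mB; apply: sub_sigma_algebra; rewrite setTI.
exists (fun k => if k == i then B else setT); first by move=> k; case: ifP.
apply/seteqP; split => x; last by move=> /(_ i iV); rewrite /= eqxx.
by move=> xB k _ /=; case: ifP => // /eqP ->.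
Qed.

Lemma adapted_preimage V Z (B : set R) : adapted V Z -> measurable B ->
  <<s cylinders V >> (Z @^-1` B).
Proof. by move=> aZ mB; have := aZ measurableT _ mB; rewrite setTI. Qed.

Lemma adapted_measurable V Z : adapted V Z -> measurable_fun setT Z.
Proof.
move=> aZ _ B mB; rewrite setTI.
apply: (smallest_sub (@sigma_algebra_measurable _ Omega) (@cylinders_measurable V)).
exact: adapted_preimage.
Qed.

Lemma adapted_mul_indep (V : {fset I}) u (Z : Omega -> R) (c : R) (g : R -> R) :
  [set` V] `<=` D -> D u -> u \notin V -> adapted V Z -> (forall x, `|Z x| <= c) ->
  measurable_fun setT g -> P.-integrable setT (EFin \o (fun x => g (X u x))) ->
  \int[P]_x (Z x * g (X u x)) = (\int[P]_x Z x) * \int[P]_x g (X u x).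
Proof.
move=> VD Du uV aZ Zc mg ig; apply: Rintegral_mul_indep Zc ig.
- exact: adapted_measurable aZ.
- exact: measurableT_comp.
- move=> A B mA mB.
  have mgB : measurable (g @^-1` B) by rewrite -[_ @^-1` _]setTI; exact: mg.
  exact: (cylinders_indep VD Du uV mgB (adapted_preimage aZ mA)).
Qed.

End independence.

(** One factor e^2 is kept for t^2 w^2; in the other terms |e| <= w and every power of |a| is at
    most 1 + a^8. The binomial coefficients from the second order on sum to 247, at most 256. *)
Lemma pow8_expansion (R : realType) (a e t w : R) : 0 <= t <= 1 -> 1 <= w ->
  `|e| <= t * w ->
  (a + e) ^+ 8 <= a ^+ 8 + 8 * a ^+ 7 * e + 256 * t ^+ 2 * (w ^+ 8 * (1 + a ^+ 8)).
Proof.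
move=> /andP[t0 t1] w1 etw.
have w0 : 0 <= w by lra.
have a8 : 0 <= a ^+ 8 by rewrite exprn_even_ge0.
have pa i : (i <= 8)%N -> `|a| ^+ i <= 1 + a ^+ 8.
  move=> i8; have [a1|a1] := leP `|a| 1.
    by apply: (@le_trans _ _ 1); [exact: exprn_ile1|lra].
  apply: (@le_trans _ _ (`|a| ^+ 8)); first by rewrite ler_weXn2l// ltW.
  by rewrite -normrX ger0_norm//; lra.
have ew : `|e| <= w by rewrite (le_trans etw)// ler_piMl.
have pe i : (i <= 6)%N -> `|e| ^+ i <= w ^+ 6.
  move=> i6; apply: (@le_trans _ _ (w ^+ i)); first by rewrite lerXn2r ?nnegrE.
  by rewrite ler_weXn2l.
have pae i k : (i <= 8)%N -> (k <= 6)%N -> `|a ^+ i * e ^+ k| <= (1 + a ^+ 8) * w ^+ 6.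
  by move=> i8 k6; rewrite normrM !normrX ler_pM ?exprn_ge0 ?pa ?pe.
pose Q := 28 * a ^+ 6 + 56 * (a ^+ 5 * e) + 70 * (a ^+ 4 * e ^+ 2) +
  56 * (a ^+ 3 * e ^+ 3) + 28 * (a ^+ 2 * e ^+ 4) + 8 * (a * e ^+ 5) + e ^+ 6.
have -> : (a + e) ^+ 8 = a ^+ 8 + 8 * a ^+ 7 * e + e ^+ 2 * Q by rewrite /Q; ring.
rewrite lerD2l.
have QE : Q <= 256 * ((1 + a ^+ 8) * w ^+ 6).
  have M0 : 0 <= (1 + a ^+ 8) * w ^+ 6 by rewrite mulr_ge0 ?exprn_ge0//; lra.
  have := pae 6%N 0%N isT isT; have := pae 5%N 1%N isT isT.
  have := pae 4%N 2%N isT isT; have := pae 3%N 3%N isT isT.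
  have := pae 2%N 4%N isT isT; have := pae 1%N 5%N isT isT.
  have := pae 0%N 6%N isT isT; rewrite expr0 !expr1 mulr1 mul1r /Q.
  move: M0; move: (_ * w ^+ 6) (a ^+ 6) (a ^+ 5 * e) (a ^+ 4 * _) (a ^+ 3 * _) (a ^+ 2 * _)
    (a * _) (e ^+ 6) => M x1 x2 x3 x4 x5 x6 x7 M0.
  by rewrite !ler_norml => /andP[_ ?] /andP[_ ?] /andP[_ ?] /andP[_ ?] /andP[_ ?] /andP[_ ?] /andP[_ ?]; lra.
have e2 : e ^+ 2 <= t ^+ 2 * w ^+ 2.
  by rewrite -exprMn -[leLHS]real_normK ?num_real// lerXn2r ?nnegrE// mulr_ge0.
apply: (@le_trans _ _ (e ^+ 2 * (256 * ((1 + a ^+ 8) * w ^+ 6)))).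
  by rewrite ler_wpM2l// sqr_ge0.
rewrite [leRHS](_ : _ = t ^+ 2 * w ^+ 2 * (256 * ((1 + a ^+ 8) * w ^+ 6))); last by ring.
rewrite ler_wpM2r// mulr_ge0// mulr_ge0 ?exprn_ge0//; lra.
Qed.

Section moment_step.
Context d (Omega : measurableType d) (R : realType) (P : probability Omega R).
Variables (I : choiceType) (D : set I) (X : I -> {RV P >-> R}).
Hypothesis Xind : mutually_independent D X.

(* Since X u is centred, has variance 1 and is independent of a, B1 and B2, the part of
   the increment e that is linear in B1 and B2 is uncorrelated with a^7: the growth factor
   is 1 + O(h + t^2) rather than 1 + O(t). *)
Lemma moment8_step (V : {fset I}) u (a e B1 B2 : Omega -> R) (ca cb C t h L : R) :
  [set` V] `<=` D -> D u -> u \notin V ->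
  adapted X V a -> adapted X V B1 -> adapted X V B2 ->
  (forall x, `|a x| <= ca) -> (forall x, `|B1 x| <= cb) -> (forall x, `|B2 x| <= cb) ->
  measurable_fun setT e -> 0 <= t <= 1 -> 0 <= h -> 1 <= C ->
  (forall x, `|e x| <= t * (C * (1 + `|X u x|))) ->
  (forall x, `|e x - B1 x * X u x - B2 x * (X u x ^+ 2 - 1)| <=
     h * (C * (1 + `|X u x|)) ^+ 3) ->
  P.-integrable setT (EFin \o (fun x => (C * (1 + `|X u x|)) ^+ 8)) ->
  \int[P]_x X u x = 0 -> \int[P]_x (X u x ^+ 2) = 1 ->
  \int[P]_x ((C * (1 + `|X u x|)) ^+ 8) <= L ->
  P.-integrable setT (EFin \o (fun x => (a x + e x) ^+ 8)) /\
  1 + \int[P]_x ((a x + e x) ^+ 8) <=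
    (1 + \int[P]_x (a x ^+ 8)) * (1 + (8 * h + 256 * t ^+ 2) * L).
Proof.
move=> VD Du uV aa aB1 aB2 ba bB1 bB2 me t01 h0 C1 et eh iW8 EY EY2 EW.
have /andP[t0 t1] := t01.
set Y := X u in et eh iW8 EY EY2 EW *.
(* Since W dominates both 1 and |Y|, its eighth power is a common integrable majorant for Y, Y^2 and
   the remainder. *)
pose W x := C * (1 + `|Y x|).
have W1 x : 1 <= W x.
  by rewrite /W -[leLHS]mul1r ler_pM//; rewrite lerDl.
have W0 x : 0 <= W x by rewrite (le_trans _ (W1 x)).
have W38 x : W x ^+ 3 <= W x ^+ 8 by rewrite ler_weXn2l.
have mY : measurable_fun setT Y by exact: measurable_funP.
have ma := adapted_measurable aa.
have YW x : `|Y x| <= W x ^+ 8.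
  apply: (@le_trans _ _ (W x)); last by rewrite -{1}[W x]expr1 ler_weXn2l.
  rewrite /W; apply: (@le_trans _ _ (1 * (1 + `|Y x|))); first by lra.
  by rewrite ler_wpM2r//; have := normr_ge0 (Y x); lra.
have Ysq x : Y x ^+ 2 <= W x ^+ 8 - 1.
    apply: (@le_trans _ _ (W x ^+ 2 - 1)); last by rewrite lerD2r ler_weXn2l.
    have h1 : 1 + `|Y x| <= W x.
      by rewrite /W -[leLHS]mul1r ler_wpM2r// addr_ge0.
    have h2 : (1 + `|Y x|) ^+ 2 <= W x ^+ 2 by rewrite lerXn2r ?nnegrE ?addr_ge0.
    have := normr_ge0 (Y x); rewrite -(real_normK (num_real (Y x))).
    by move: h2; rewrite sqrrD; lra.
have Y2W x : `|Y x ^+ 2 - 1| <= W x ^+ 8.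
  have := Ysq x; have := sqr_ge0 (Y x); rewrite ler_norml => ? ?.
  by apply/andP; split; lra.
have iYsq : P.-integrable setT (EFin \o (fun x => Y x ^+ 2)).
  apply: (le_integrable_EFin _ _ iW8); first exact: measurable_funX.
  by move=> x; have := Ysq x; rewrite ger0_norm ?sqr_ge0//; rewrite -/(W x); lra.
have iY : P.-integrable setT (EFin \o Y) by exact: le_integrable_EFin YW iW8.
have iY2 : P.-integrable setT (EFin \o (fun x => Y x ^+ 2 - 1)).
  apply: le_integrable_EFin Y2W iW8; apply: measurable_funB => //.
  exact: measurable_funX.
have ca0 : 0 <= ca.
  have [x _] : [set: Omega] !=set0.
    by apply/set0P/eqP => T0; have := probability_setT P; rewrite T0 measure0 => /eqP; rewrite eqe eq_sym oner_eq0.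
  exact: le_trans (ba x).
have cb0 : 0 <= cb.
  have [x _] : [set: Omega] !=set0.
    by apply/set0P/eqP => T0; have := probability_setT P; rewrite T0 measure0 => /eqP; rewrite eqe eq_sym oner_eq0.
  exact: le_trans (bB1 x).
have a8b x : `|a x ^+ 8| <= ca ^+ 8 by rewrite normrX lerXn2r ?nnegrE.
have ia8 : P.-integrable setT (EFin \o (fun x => a x ^+ 8)).
  by apply: integrable_EFin_bounded a8b; exact: measurable_funX.
have aA7 B : adapted X V B -> adapted X V (fun x => 8 * (a x ^+ 7 * B x)).
  by move=> aB; apply: measurable_funM => //; apply: measurable_funM => //; exact: measurable_funX.
have bA7 B : (forall x, `|B x| <= cb) -> forall x, `|8 * (a x ^+ 7 * B x)| <= 8 * (ca ^+ 7 * cb).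
  move=> bB x; rewrite normrM ger0_norm// ler_wpM2l// normrM ler_pM// normrX.
  by rewrite lerXn2r ?nnegrE.
have iBg (Z g : Omega -> R) c : measurable_fun setT Z -> (forall x, `|Z x| <= c) -> 0 <= c ->
    P.-integrable setT (EFin \o g) -> P.-integrable setT (EFin \o (fun x => Z x * g x)).
  move=> mZ bZ c0 ig.
  apply: (le_integrable_EFin _ _ (integrable_EFinZ c (integrable_norm ig))).
    by apply: measurable_funM => //; exact/measurable_EFinP/(measurable_int P ig).
  by move=> x; rewrite /= normrM ler_wpM2r.
have c7 : 0 <= 8 * (ca ^+ 7 * cb) by rewrite !mulr_ge0 ?exprn_ge0.
have i1 := iBg _ _ _ (adapted_measurable (aA7 _ aB1)) (bA7 _ bB1) c7 iY.
have i2 := iBg _ _ _ (adapted_measurable (aA7 _ aB2)) (bA7 _ bB2) c7 iY2.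
have E1 : \int[P]_x (8 * (a x ^+ 7 * B1 x) * Y x) = 0.
  rewrite (adapted_mul_indep Xind VD Du uV (aA7 _ aB1) (bA7 _ bB1) (@measurable_id _ _ _) iY).
  by rewrite EY mulr0.
have E2 : \int[P]_x (8 * (a x ^+ 7 * B2 x) * (Y x ^+ 2 - 1)) = 0.
  have mg : measurable_fun setT (fun y : R => y ^+ 2 - 1).
    by apply: measurable_funB => //; exact: measurable_funX.
  rewrite (adapted_mul_indep Xind VD Du uV (aA7 _ aB2) (bA7 _ bB2) mg iY2).
  rewrite RintegralB//; last exact: integrable_EFin_cst.
  by rewrite EY2 Rintegral_probability_cst subrr mulr0.
have a1a : adapted X V (fun x => 1 + a x ^+ 8).
  by apply: measurable_funD => //; exact: measurable_funX.
have a1b x : `|1 + a x ^+ 8| <= 1 + ca ^+ 8.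
  by apply: le_trans (ler_normD _ _) _; rewrite normr1 lerD2l.
have mg8 : measurable_fun setT (fun y : R => (C * (1 + `|y|)) ^+ 8).
  by apply: measurable_funX; apply: measurable_funM => //; apply: measurable_funD.
have i3 := iBg _ _ _ (adapted_measurable a1a) a1b (le_trans (normr_ge0 _) (a1b point)) iW8.
have E3 : \int[P]_x ((1 + a x ^+ 8) * (C * (1 + `|Y x|)) ^+ 8) =
    (1 + \int[P]_x (a x ^+ 8)) * \int[P]_x ((C * (1 + `|Y x|)) ^+ 8).
  rewrite (adapted_mul_indep Xind VD Du uV a1a a1b mg8 iW8) RintegralD//; last first.
    exact: integrable_EFin_cst.
  by rewrite Rintegral_probability_cst.
pose k := 8 * h + 256 * t ^+ 2.
have k0 : 0 <= k by rewrite addr_ge0// mulr_ge0// sqr_ge0.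
(* A pointwise majorant of the eighth power. By independence its second and third terms integrate to
   zero and the integral of the last one factorizes. *)
pose T8 x := a x ^+ 8 + 8 * (a x ^+ 7 * B1 x) * Y x +
  8 * (a x ^+ 7 * B2 x) * (Y x ^+ 2 - 1) +
  k * ((1 + a x ^+ 8) * (C * (1 + `|Y x|)) ^+ 8).
have i12 := integrable_EFinD (integrable_EFinD ia8 i1) i2.
have iT8 : P.-integrable setT (EFin \o T8).
  exact: integrable_EFinD i12 (integrable_EFinZ k i3).
have leT8 x : (a x + e x) ^+ 8 <= T8 x.
  apply: le_trans (pow8_expansion (a x) t01 (W1 x) (et x)) _.
  pose r := e x - B1 x * Y x - B2 x * (Y x ^+ 2 - 1).
  have rW : `|r| <= h * W x ^+ 8 := le_trans (eh x) (ler_wpM2l h0 (W38 x)).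
  have a7 : `|a x ^+ 7| <= 1 + a x ^+ 8.
    have a8 : 0 <= a x ^+ 8 by rewrite exprn_even_ge0.
    rewrite normrX; have [a1|a1] := leP `|a x| 1.
      by apply: (@le_trans _ _ 1); [exact: exprn_ile1|lra].
    apply: (@le_trans _ _ (`|a x| ^+ 8)); first by rewrite ler_weXn2l// ltW.
    by rewrite -normrX ger0_norm//; lra.
  have ar : a x ^+ 7 * r <= (1 + a x ^+ 8) * (h * W x ^+ 8).
    by rewrite (le_trans (ler_norm _))// normrM ler_pM.
  rewrite /T8 /k -/(W x).
  have -> : 8 * a x ^+ 7 * e x = 8 * (a x ^+ 7 * B1 x) * Y x +
     8 * (a x ^+ 7 * B2 x) * (Y x ^+ 2 - 1) + 8 * (a x ^+ 7 * r) by rewrite /r; ring.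
  lra.
have i8 : P.-integrable setT (EFin \o (fun x => (a x + e x) ^+ 8)).
  apply: le_integrable_EFin iT8.
    by apply: measurable_funX; exact: measurable_funD.
  by move=> x; rewrite ger0_norm ?exprn_even_ge0.
split => //.
have := RintegralT_le i8 iT8 leT8.
rewrite /T8 RintegralD//; last exact: integrable_EFinZ.
rewrite RintegralD//; last exact: integrable_EFinD.
rewrite RintegralD// E1 E2 !addr0 RintegralZl// E3 => h8.
rewrite mulrDr mulr1 -addrA lerD2l; apply: le_trans h8 _.
rewrite lerD2l -/k mulrCA ler_wpM2l//; first by rewrite addr_ge0// Rintegral_ge0// => x _; rewrite exprn_even_ge0.
by rewrite ler_wpM2l.
Qed.

End moment_step.

(** * Averages over paths *)

Section path_average.
Variables (R : realType) (I : choiceType).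
Implicit Types (S : seq (seq I)) (g : seq I -> R).

Definition path_avg S g : R := (size S)%:R^-1 * \sum_(s <- S) g s.

Definition hit_prob S (v : I) : R := path_avg S (fun s => (v \in s)%:R).

Lemma path_avg_eq S g g' : {in S, g =1 g'} -> path_avg S g = path_avg S g'.
Proof. by move=> gg'; rewrite /path_avg (eq_big_seq _ gg'). Qed.

Lemma path_avgB S g g' : path_avg S (fun s => g s - g' s) = path_avg S g - path_avg S g'.
Proof. by rewrite /path_avg sumrB mulrBr. Qed.

Lemma path_avgZ S k g : path_avg S (fun s => k * g s) = k * path_avg S g.
Proof. by rewrite /path_avg -mulr_sumr mulrCA. Qed.

Lemma path_avgZr S k g : path_avg S (fun s => g s * k) = path_avg S g * k.
Proof. by rewrite /path_avg -mulr_suml mulrA. Qed.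

Lemma path_avg_le S g g' : {in S, forall s, g s <= g' s} -> path_avg S g <= path_avg S g'.
Proof.
move=> gg'; rewrite ler_wpM2l ?invr_ge0//.
by rewrite big_seq [leRHS]big_seq; apply: ler_sum => s /gg'.
Qed.

Lemma path_avg_norm S g : `|path_avg S g| <= path_avg S (fun s => `|g s|).
Proof.
by rewrite normrM ger0_norm ?invr_ge0// ler_wpM2l ?invr_ge0// ler_norm_sum.
Qed.

Lemma path_avg_cst S k : S != [::] -> path_avg S (fun=> k) = k.
Proof.
move=> S0; rewrite /path_avg big_const_seq count_predT iter_addr_0 -[k *+ _]mulr_natl.
by rewrite mulKf// pnatr_eq0 size_eq0.
Qed.

Lemma path_avg_bound S g c : S != [::] -> (forall s, `|g s| <= c) -> `|path_avg S g| <= c.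
Proof.
move=> S0 gc; apply: le_trans (path_avg_norm _ _) _.
by rewrite -[leRHS](path_avg_cst c S0); apply: path_avg_le => s _.
Qed.

Lemma path_avg_sum S (J : Type) (V : seq J) (F : J -> seq I -> R) :
  path_avg S (fun s => \sum_(v <- V) F v s) = \sum_(v <- V) path_avg S (F v).
Proof. by rewrite /path_avg exchange_big /= mulr_sumr. Qed.

Lemma hit_prob_ge0 S v : 0 <= hit_prob S v.
Proof. by rewrite mulr_ge0 ?invr_ge0// sumr_ge0. Qed.

Lemma hit_prob_le1 S v : S != [::] -> hit_prob S v <= 1.
Proof.
by move=> S0; rewrite -(path_avg_cst 1 S0); apply: path_avg_le => s _; case: (v \in s).
Qed.

(** Double counting: each path contributes 1 for each of its [n] distinct points. *)
Lemma sum_hit_prob S (V : seq I) n : S != [::] -> uniq V ->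
  {in S, forall s, [/\ uniq s, {subset s <= V} & size s = n]} ->
  \sum_(v <- V) hit_prob S v = n%:R.
Proof.
move=> S0 uV HS; rewrite -path_avg_sum -(path_avg_cst n%:R S0).
apply: path_avg_eq => s /HS[us sV <-]; rewrite -natr_sum; congr (_%:R).
transitivity (count (mem s) V).
  by rewrite -sum1_count [RHS]big_mkcond; apply: eq_bigr => v _ /=; case: (v \in s).
rewrite -size_filter; apply/perm_size/uniq_perm => //.
  exact: filter_uniq.
by move=> v; rewrite mem_filter andb_idr// => /sV.
Qed.

End path_average.

(** The growth factor of one replacement: [8 * h] with h = 66 q^5 p gives 528 q^5 p, and t = q p
    gives the other term. Its sign is needed to multiply the inequalities of successive steps. *)
Lemma step_factor_ge0 (R : realType) (q p L : R) : 0 <= q -> 0 <= p -> 0 <= L ->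
  0 <= 1 + (528 * q ^+ 5 * p + 256 * (q * p) ^+ 2) * L.
Proof.
move=> q0 p0 L0; apply: addr_ge0; first exact: ler01.
apply: mulr_ge0 L0; apply: addr_ge0.
  by apply: mulr_ge0 p0; apply: mulr_ge0 (exprn_ge0 5 q0); rewrite ler0n.
by apply: mulr_ge0 (sqr_ge0 _); rewrite ler0n.
Qed.

(** * Lindeberg replacement along a family of paths *)

Section lindeberg.
Context d (Omega : measurableType d) (R : realType) (P : probability Omega R).
Variables (I : choiceType) (D : set I) (X : I -> {RV P >-> R}).
Hypothesis Xind : mutually_independent D X.
Variables (S : seq (seq I)) (V0 : seq I) (n : nat).
Hypotheses (n_gt0 : (0 < n)%N) (S0 : S != [::]) (V0_uniq : uniq V0).
Hypothesis V0D : forall v, v \in V0 -> D v.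
Hypothesis SV : {in S, forall s, [/\ uniq s, {subset s <= V0} & size s = n]}.
Variables (C L : R) (f f1 f2 : R -> R).
Hypotheses (C1 : 1 <= C) (L0 : 0 <= L) (tf : taylor_class C f f1 f2) (f_ge0 : forall x, 0 <= f x).
Hypothesis Xmean : forall v, D v -> \int[P]_x X v x = 0.
Hypothesis Xvar : forall v, D v -> \int[P]_x (X v x ^+ 2) = 1.
Hypothesis X8i : forall v, D v ->
  P.-integrable setT (EFin \o (fun x => (C * (1 + `|X v x|)) ^+ 8)).
Hypothesis X8 : forall v, D v -> \int[P]_x ((C * (1 + `|X v x|)) ^+ 8) <= L.

(* r = n^(-1/2) rescales the sums over paths; q = n^(-1/4) is the order of magnitude of
   the difference between the path average and its Gaussian value. *)
Variables (r q : R).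
Hypotheses (r_gt0 : 0 < r) (q_gt0 : 0 < q) (q2 : q ^+ 2 = r).
Hypotheses (r_le1 : r <= 1) (q_le1 : q <= 1) (r2 : r ^+ 2 = n%:R^-1).

Let h k := iter k (gauss_avg r) f.
Let h1 k := iter k (gauss_avg r) f1.
Let h2 k := iter k (gauss_avg r) f2.

Let th k : taylor_class C (h k) (h1 k) (h2 k).
Proof. by elim: k => [//|k ih]; exact: taylor_class_avg. Qed.

Let ch k : continuous (h k). Proof. exact: lipschitz_continuousR (tc_lip (th k)). Qed.
Let ch1 k : continuous (h1 k). Proof. exact: lipschitz_continuousR (tc_lip1 (th k)). Qed.
Let ch2 k : continuous (h2 k). Proof. exact: lipschitz_continuousR (tc_lip2 (th k)). Qed.

(* The weights outside V are replaced by centred Gaussian steps of variance 1/n. *)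
Let remaining (V : {fset I}) (s : seq I) : nat := count [pred v | v \notin V] s.
Let psum (V : {fset I}) (s : seq I) (x : Omega) : R :=
  r * \sum_(v <- s | v \in V) X v x.
Let Phi (V : {fset I}) (x : Omega) : R :=
  path_avg S (fun s => h (remaining V s) (psum V s x)).

Let adapted_avg (V : {fset I}) (g : seq I -> R -> R) : (forall s, continuous (g s)) ->
  adapted X V (fun x => path_avg S (fun s => g s (psum V s x))).
Proof.
move=> cg; apply: measurable_funM => //; apply: measurable_sum => s.
apply: measurableT_comp; first exact: continuous_measurable_fun.
apply: measurable_funM => //.
have -> : (fun x => \sum_(v <- s | v \in V) X v x) =
    (fun x => \sum_(v <- s) (if v \in V then X v x else 0)).
  by apply/funext => x; rewrite big_mkcond.
have mv v : adapted X V (fun x => if v \in V then X v x else 0).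
  by have [vV|_] := boolP (v \in V); [exact: adapted_rv|exact: measurable_cst].
exact: (@measurable_sum _ (g_sigma_algebraType (cylinders X V)) _ _ _ s _ mv).
Qed.

(** A path that avoids [u] keeps both its sum and its number of Gaussian steps. On a path through
    [u], one Gaussian step is exchanged for the increment [r * X u x]. *)
Let Phi_step (V : {fset I}) u x : u \notin V -> Phi (u |` V)%fset x - Phi V x =
  path_avg S (fun s => (u \in s)%:R *
    (h (remaining (u |` V)%fset s) (psum V s x + r * X u x) -
     h (remaining (u |` V)%fset s).+1 (psum V s x))).
Proof.
move=> uV; rewrite -path_avgB; apply: path_avg_eq => s /SV[us _ _].
have [us'|us'] := boolP (u \in s); last first.
  rewrite mul0r; apply/eqP; rewrite subr_eq0; apply/eqP; congr h.
    by apply: eq_in_count => v vs /=; rewrite !inE negb_or;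
       case: eqP vs => // ->; rewrite (negbTE us').
  congr (_ * _); rewrite big_seq_cond [RHS]big_seq_cond; apply: eq_bigl => v.
  rewrite !inE; have [vs|//] := boolP (v \in s).
  by case: eqP vs => // ->; rewrite (negbTE us').
rewrite mul1r; congr (h _ _ - h _ _).
- rewrite /psum -mulrDr; congr (_ * _).
  rewrite (bigID [pred v | v == u]) /= addrC; congr (_ + _).
    apply: eq_bigl => v; rewrite !inE; case: eqP => [->|_] /=; rewrite ?(negbTE uV)//.
    by rewrite andbT.
  rewrite (eq_bigl [pred v | v == u]); last first.
    by move=> v; rewrite !inE /=; case: eqP => //; rewrite andbF.
  by rewrite -big_filter filter_pred1_uniq// big_seq1.
- rewrite /remaining -addn1 -[X in (_ + X)%N](_ : count (pred1 u) s = 1%N); last first.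
    by rewrite count_uniq_mem ?us'.
  rewrite -count_predUI [X in (_ + X)%N](@eq_count _ _ pred0) ?count_pred0 ?addn0.
    apply: eq_count => v; rewrite /= !inE; case: eqP => [->|_] /=; last by rewrite orbF.
    by rewrite (negbTE uV).
  by move=> v; rewrite /= !inE; case: eqP => //=; rewrite andbF.
Qed.

(** [h n 0] is the Gaussian integral of [f], being the outcome of n steps of variance 1/n. Division
    by [q] brings the difference to order 1. *)
Let moment (V : {fset I}) : R :=
  1 + \int[P]_x ((q^-1 * (Phi V x - h n 0)) ^+ 8).

Let cgM k (F : R -> R) : continuous F -> continuous (fun y => k * F y).
Proof. by move=> cF y; apply: cvgM; [exact: cvg_cst|exact: cF]. Qed.

(** An instance of [moment8_step]. Since r = q^2, the first-order size r of an increment becomes r /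
    q = q after scaling, and the third-order remainder r^3 / q = q^5. Averaging over paths
    multiplies both by the probability of visiting [u]. *)
Let moment_stepV (V : {fset I}) u : [set` V] `<=` D -> D u -> u \notin V ->
  moment (u |` V)%fset <=
  moment V * (1 + (528 * q ^+ 5 * hit_prob R S u + 256 * (q * hit_prob R S u) ^+ 2) * L).
Proof.
move=> VD Du uV; set p := hit_prob R S u.
have p0 : 0 <= p by exact: hit_prob_ge0.
have p1 : p <= 1 by exact: hit_prob_le1.
have C0 : 0 <= C := le_trans ler01 C1.
have qi0 : 0 <= q^-1 by rewrite invr_ge0 ltW.
pose c s := remaining (u |` V)%fset s.
pose a x := q^-1 * (Phi V x - h n 0).
pose e x := q^-1 * (Phi (u |` V)%fset x - Phi V x).
(* The coefficients of X u and of (X u)^2 - 1 in the expansion of the increment; they depend only on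
   the weights in V. *)
pose B1 x := path_avg S (fun s => q^-1 * ((u \in s)%:R * (r * h1 (c s) (psum V s x)))).
pose B2 x := path_avg S (fun s => q^-1 * ((u \in s)%:R * (r ^+ 2 / 2 * h2 (c s) (psum V s x)))).
have aPhi W : adapted X W (Phi W) := @adapted_avg W (fun s => h (remaining W s)) (fun s => @ch _).
have aa : adapted X V a.
  apply: measurable_funM; first exact: measurable_cst.
  exact: (measurable_funB (aPhi V) (measurable_cst _)).
have aB1 : adapted X V B1.
  apply: (@adapted_avg V (fun s y => q^-1 * ((u \in s)%:R * (r * h1 (c s) y)))) => s.
  by do 3 apply: cgM; exact: ch1.
have aB2 : adapted X V B2.
  apply: (@adapted_avg V (fun s y => q^-1 * ((u \in s)%:R * (r ^+ 2 / 2 * h2 (c s) y)))) => s.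
  by do 3 apply: cgM; exact: ch2.
have bPhi W x : `|Phi W x| <= C.
  by apply: path_avg_bound => // s; exact: tc_bound (th _) _.
have ba x : `|a x| <= q^-1 * (C + C).
  rewrite /a normrM ger0_norm// ler_wpM2l// (le_trans (ler_normB _ _))// lerD//.
  exact: tc_bound (th _) _.
have us1 (s : seq I) : `|(u \in s)%:R : R| <= 1.
  by case: (u \in s); rewrite ?normr1 ?normr0.
have bB1 x : `|B1 x| <= q^-1 * C.
  apply: path_avg_bound => // s; rewrite normrM ger0_norm// ler_wpM2l// !normrM.
  rewrite -[leRHS]mul1r ler_pM// ?mulr_ge0// -[leRHS]mul1r ler_pM//.
    by rewrite ger0_norm// ltW.
  exact: tc_bound1 (th _) _.
have r21 : `|r ^+ 2 / 2| <= 1.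
  rewrite ger0_norm ?divr_ge0 ?sqr_ge0//.
  have : r ^+ 2 <= 1 by rewrite exprn_ile1// ltW.
  by lra.
have bB2 x : `|B2 x| <= q^-1 * C.
  apply: path_avg_bound => // s; rewrite normrM ger0_norm// ler_wpM2l// !(normrM (u \in s)%:R) !(normrM (r ^+ 2 / 2)).
  rewrite -[leRHS]mul1r ler_pM// ?mulr_ge0// -[leRHS]mul1r ler_pM//.
  exact: tc_bound2 (th _) _.
have me : measurable_fun setT e.
  by apply: measurable_funM => //; apply: measurable_funB; exact: (adapted_measurable (aPhi _)).
have eE x : e x = path_avg S (fun s => q^-1 * ((u \in s)%:R *
    (h (c s) (psum V s x + r * X u x) - h (c s).+1 (psum V s x)))).
  by rewrite /e Phi_step// -path_avgZ.
have qr : q^-1 * r = q by rewrite -q2 expr2 mulKf// gt_eqF.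
have qr3 : q^-1 * r ^+ 3 = q ^+ 5.
  by rewrite exprS mulrA qr -q2 -exprM -exprS.
have et x : `|e x| <= q * p * (C * (1 + `|X u x|)).
  rewrite eE; apply: le_trans (path_avg_norm _ _) _.
  rewrite /p /hit_prob -path_avgZ -path_avgZr; apply: path_avg_le => s _.
  rewrite !normrM (ger0_norm qi0) (ger0_norm (ler0n _ _)).
  rewrite -[q in leRHS]qr [leRHS](_ : _ = q^-1 * ((u \in s)%:R * (r * (C * (1 + `|X u x|))))); last by ring.
  rewrite ler_wpM2l// ler_wpM2l//.
  apply: le_trans (gauss_avg_step1 r_gt0 _ _ (th _)) _.
  by rewrite normrM (gtr0_norm r_gt0) le_eqVlt; apply/orP; left; apply/eqP; ring.
have eh x : `|e x - B1 x * X u x - B2 x * (X u x ^+ 2 - 1)| <=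
    66 * q ^+ 5 * p * (C * (1 + `|X u x|)) ^+ 3.
  rewrite eE /B1 /B2 -!path_avgZr -!path_avgB; apply: le_trans (path_avg_norm _ _) _.
  rewrite /p /hit_prob -path_avgZ -path_avgZr; apply: path_avg_le => s _.
  rewrite (_ : _ - _ = q^-1 * ((u \in s)%:R * (h (c s) (psum V s x + r * X u x) -
    gauss_avg r (h (c s)) (psum V s x) - (r * X u x) * h1 (c s) (psum V s x) -
    ((r * X u x) ^+ 2 - r ^+ 2) / 2 * h2 (c s) (psum V s x)))); last first.
    by rewrite /h iterS; field; rewrite gt_eqF.
  rewrite !normrM (ger0_norm qi0) (ger0_norm (ler0n _ _)).
  rewrite -qr3 [leRHS](_ : _ = q^-1 * ((u \in s)%:R * (r ^+ 3 * 66 * (C * (1 + `|X u x|)) ^+ 3))); last by ring.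
  rewrite ler_wpM2l// ler_wpM2l//.
  apply: le_trans (gauss_avg_step3 r_gt0 _ _ (th _)) _.
  rewrite normrM (gtr0_norm r_gt0) exprMn.
  rewrite [leLHS](_ : _ = r ^+ 3 * (C * (`|X u x| ^+ 3 + 66))); last by ring.
  rewrite -mulrA ler_wpM2l ?exprn_ge0 ?(ltW r_gt0)// exprMn.
  have y0 : 0 <= `|X u x| by [].
  have C3 : C <= C ^+ 3 by rewrite -[leLHS]expr1 ler_weXn2l.
  rewrite mulrCA ler_pM//.
  have -> : (1 + `|X u x|) ^+ 3 = 1 + 3 * `|X u x| + 3 * `|X u x| ^+ 2 + `|X u x| ^+ 3 by ring.
  by have := exprn_ge0 2 y0; have := exprn_ge0 3 y0; lra.
have t01 : 0 <= q * p <= 1.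
  by rewrite mulr_ge0 ?(ltW q_gt0)//= mulr_ile1// ltW.
have h0 : 0 <= 66 * q ^+ 5 * p.
  by apply: mulr_ge0 p0; apply: mulr_ge0 (exprn_ge0 5 (ltW q_gt0)); rewrite ler0n.
have [_] := moment8_step Xind VD Du uV aa aB1 aB2 ba bB1 bB2 me t01 h0 C1 et eh
  (X8i Du) (Xmean Du) (Xvar Du) (X8 Du).
rewrite /moment; have -> : 8 * (66 * q ^+ 5 * p) = 528 * q ^+ 5 * p by ring.
by under eq_Rintegral do rewrite /a /e -mulrDr addrC addrA subrK.
Qed.

Let moment_seq (l : seq I) : uniq l -> {subset l <= V0} ->
  moment [fset v in l]%fset <=
  expR (\sum_(v <- l) (528 * q ^+ 5 * hit_prob R S v + 256 * (q * hit_prob R S v) ^+ 2) * L).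
Proof.
elim: l => [_ _|u l ih /= /andP[ul ull] lV].
  rewrite big_nil expR0 /moment.
  under eq_Rintegral => x _.
    (* With no weight kept, every path carries exactly n Gaussian steps, since all paths have n
       points; the initial moment is therefore 1. *)
    have -> : Phi [fset v in [::]]%fset x = h n 0.
      rewrite /Phi -[RHS](path_avg_cst _ S0); apply: path_avg_eq => s /SV[_ _ sn].
      congr h.
        by rewrite /remaining -sn -count_predT; apply: eq_count => v; rewrite /= !inE.
      by rewrite /psum big1 ?mulr0// => v; rewrite !inE.
    rewrite subrr mulr0 expr0n /=.
    over.
  by rewrite Rintegral_probability_cst addr0.
have -> : [fset v in u :: l]%fset = (u |` [fset v in l])%fset.
  by apply/fsetP => v; rewrite !inE.
have lV' : {subset l <= V0} by move=> v vl; apply: lV; rewrite inE vl orbT.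
apply: le_trans (moment_stepV _ _ _) _.
- by move=> v /=; rewrite !inE => vl; exact/V0D/lV'.
- by apply/V0D/lV; rewrite mem_head.
- by rewrite !inE.
rewrite big_cons expRD [leRHS]mulrC; apply: ler_pM.
- by rewrite addr_ge0// Rintegral_ge0// => x _; rewrite exprn_even_ge0.
- exact: step_factor_ge0 (ltW q_gt0) (hit_prob_ge0 R S u) L0.
- exact: ih.
- exact: expR_ge1Dx.
Qed.

(** In the exponent, the terms q^5 p_v sum to q^5 n = q <= 1, and the terms q^2 p_v^2 to at most r K
    / r = K. Undoing the scaling multiplies by q^8 = n^(-2). *)
Lemma lindeberg_moment8 (K : R) :
  \sum_(v <- V0) hit_prob R S v ^+ 2 <= K * r^-1 ->
  measurable_fun setT (fun x => path_avg S (fun s => f (r * \sum_(v <- s) X v x))) /\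
  \int[P]_x ((path_avg S (fun s => f (r * \sum_(v <- s) X v x)) -
     \int[normal_prob 0 1]_y f y) ^+ 8) <= n%:R^-1 ^+ 2 * expR (L * (528 + 256 * K)).
Proof.
move=> p2.
have PhiE x : Phi [fset v in V0]%fset x = path_avg S (fun s => f (r * \sum_(v <- s) X v x)).
  apply: path_avg_eq => s /SV[_ sV _].
  have -> : remaining [fset v in V0]%fset s = 0%N.
    apply/eqP; rewrite -leqn0 leqNgt -has_count; apply/hasPn => v /sV /= vV.
    by rewrite !inE negbK.
  rewrite /= /psum big_seq_cond [in RHS]big_seq; congr (f (_ * _)).
  by apply: eq_bigl => v; rewrite !inE; case: (boolP (v \in s)) => // /sV ->.
have aPhi : adapted X [fset v in V0]%fset (Phi [fset v in V0]%fset) :=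
  @adapted_avg _ (fun s => h (remaining _ s)) (fun s => @ch _).
have mPhi := adapted_measurable aPhi; rewrite (funext PhiE) in mPhi.
split => //.
have hnE : h n 0 = \int[normal_prob 0 1]_y f y.
  rewrite /h -(prednK n_gt0) (@iter_gauss_avg _ _ r_gt0 C f f1 f2 n.-1 1)//.
    by apply: eq_Rintegral => y _; rewrite add0r.
  by rewrite prednK// r2 expr1n divff// pnatr_eq0 -lt0n.
pose A x := path_avg S (fun s => f (r * \sum_(v <- s) X v x)) - \int[normal_prob 0 1]_y f y.
have Ab x : `|A x ^+ 8| <= (C + C) ^+ 8.
  rewrite normrX lerXn2r ?nnegrE ?addr_ge0 ?(le_trans ler01 C1)//.
  apply: le_trans (ler_normB _ _) _; apply: lerD.
    by apply: path_avg_bound => // s; exact: tc_bound tf _.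
  by rewrite -hnE; exact: tc_bound (th _) _.
have mA : measurable_fun setT A by apply: measurable_funB => //; exact: measurable_cst.
have iA : P.-integrable setT (EFin \o (fun x => A x ^+ 8)).
  by apply: integrable_EFin_bounded Ab; exact: measurable_funX.
have MA : moment [fset v in V0]%fset = 1 + q^-1 ^+ 8 * \int[P]_x (A x ^+ 8).
  rewrite /moment -RintegralZl//; congr (1 + _); apply: eq_Rintegral => x _.
  by rewrite PhiE hnE exprMn.
have := moment_seq V0_uniq (fun _ => id); rewrite MA.
set E := \sum_(v <- V0) _ => hE.
have EL : E <= L * (528 + 256 * K).
  rewrite /E -mulr_suml mulrC ler_wpM2l// big_split /= -mulr_sumr (sum_hit_prob _ S0 V0_uniq SV).
  under [X in _ + X]eq_bigr do rewrite exprMn mulrA.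
  rewrite -mulr_sumr; apply: lerD.
    have -> : 528 * q ^+ 5 * n%:R = 528 * q.
      rewrite exprS (_ : q ^+ 4 = n%:R^-1); last by rewrite -r2 -q2 -exprM.
      by rewrite -!mulrA mulVf ?mulr1// pnatr_eq0 -lt0n.
    by rewrite -[leRHS]mulr1; apply: ler_wpM2l q_le1; rewrite ler0n.
  rewrite -mulrA; apply: ler_wpM2l; first by rewrite ler0n.
  rewrite q2 -[K](mulfVK (lt0r_neq0 r_gt0)) [leRHS]mulrC.
  exact: ler_wpM2l (ltW r_gt0) _ _ p2.
have q8 : n%:R^-1 ^+ 2 = q ^+ 8 by rewrite -r2 -q2 -!exprM.
rewrite q8.
have q80 : 0 < q ^+ 8 by rewrite exprn_gt0.
rewrite mulrC -ler_pdivrMr// mulrC -exprVn.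
apply: le_trans (_ : expR E <= _); last by rewrite ler_expR.
by apply: le_trans hE; rewrite lerDr.
Qed.

End lindeberg.

(** * Products of binomial coefficients *)

Lemma bin_shift (l r j i : nat) : (0 < i)%N -> (j <= l)%N -> (i <= r)%N ->
  ('C(l, j.+1) * 'C(r, i.-1) * (j.+1 * (r - i).+1) = 'C(l, j) * 'C(r, i) * ((l - j) * i))%N.
Proof.
case: i => // i _ jl ir; rewrite /= subnSK//.
have h1 := mul_bin_left l j; have h2 := mul_bin_left r i.
rewrite mulnACA [X in (X * _)%N]mulnC h1 [X in (_ * X)%N]mulnC -h2.
by rewrite [RHS]mulnACA; congr (_ * _)%N; rewrite mulnC.
Qed.

(** The ratio of neighbouring terms of Vandermonde's sum with denominators cleared: one item moves
    from the second block to the first. *)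
Lemma bin_shift_path (a b a' b' k : nat) : (k < b)%N -> (k < a')%N ->
  ('C(a + b, a + k.+1) * 'C(a' + b', a' - k.+1) * ((a + k.+1) * (b' + k.+1)) =
   'C(a + b, a + k) * 'C(a' + b', a' - k) * ((b - k) * (a' - k)))%N.
Proof.
move=> kb ka'; have := @bin_shift (a + b) (a' + b') (a + k) (a' - k).
rewrite subn_gt0 ka' leq_add2l (ltnW kb) (leq_trans (leq_subr _ _) (leq_addr _ _)).
move=> /(_ isT isT isT).
have -> : (a' - k).-1 = (a' - k.+1)%N by lia.
have -> : (a' + b' - (a' - k)).+1 = (b' + k.+1)%N by lia.
have -> : (a + b - (a + k) = b - k)%N by lia.
by rewrite -addnS.
Qed.

(** The ratio of neighbouring terms is num / den. As a b' <= b a', the leading products do not count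
    against it, and den - num is at most 3 (k + 1) L. For small k, num is at least (c l / 2) (c L /
    4). If num < den, the relative loss is thus at most 24 (k + 1) / (c^2 l). *)
Lemma bin_spread_step (R : realType) (c : R) (a b a' b' k : nat) :
  let l := (a + b)%:R : R in let L := (a + b + (a' + b'))%:R : R in
  let T k := ('C(a + b, a + k) * 'C(a' + b', a' - k))%:R : R in
  0 < c -> c * l <= b%:R -> c * L / 2 <= a'%:R -> 2 * l <= L -> 0 < l -> 1 <= L ->
  (a * b' <= b * a')%N -> 2 * k.+1%:R <= c * l ->
  T k * (1 - k.+1%:R * (24 / c ^+ 2) / l) <= T k.+1.
Proof.
move=> l L T.
have T0 i : 0 <= T i by [].
have TS i : T i = ('C(a + b, a + i) * 'C(a' + b', a' - i))%:R by [].
have LE : L = a%:R + b%:R + a'%:R + b'%:R by rewrite /L !natrD; ring.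
clearbody l L T; set D := 24 / c ^+ 2; have DE0 : D = 24 / c ^+ 2 by []; clearbody D.
move=> c0 bl a'L lLR lR L1 aba kR.
have c20 : 0 < c ^+ 2 by rewrite exprn_gt0.
have D0 : 0 < D by rewrite DE0 divr_gt0.
have abaR : a%:R * b'%:R <= b%:R * a'%:R :> R by rewrite -!natrM ler_nat.
have [a0 b0 a'0 b'0] : [/\ 0 <= a%:R :> R, 0 <= b%:R :> R, 0 <= a'%:R :> R & 0 <= b'%:R :> R].
  by [].
have LR : 0 < L by lra.
have k1 : k.+1%:R = k%:R + 1 :> R by rewrite -natr1.
rewrite k1 in kR.
have k0 : 0 <= k%:R :> R by [].
have cl : c * l <= c * (L / 2) by rewrite ler_wpM2l ?(ltW c0)//; lra.
have k2b : 2 * k%:R <= b%:R :> R by lra.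
have k2a' : 2 * k%:R <= a'%:R :> R by lra.
have kb : (k < b)%N by rewrite -(ltr_nat R); lra.
have ka' : (k < a')%N by rewrite -(ltr_nat R); lra.
have E : T k.+1 * ((a + k.+1)%:R * (b' + k.+1)%:R) = T k * ((b%:R - k%:R) * (a'%:R - k%:R)).
  rewrite !TS -natrB; last exact: ltnW.
  rewrite -natrB; last exact: ltnW.
  rewrite -!natrM; congr (_%:R).
  exact: bin_shift_path.
have denE : (a + k.+1)%:R * (b' + k.+1)%:R = (a%:R + k%:R + 1) * (b'%:R + k%:R + 1) :> R.
  by rewrite !natrD k1 !addrA.
rewrite denE in E.
have den0 : 0 < (a%:R + k%:R + 1) * (b'%:R + k%:R + 1) :> R.
  by rewrite mulr_gt0// ltr_wpDl// addr_ge0.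
rewrite -(ler_pM2r den0) E -[leLHS]mulrA; apply: (ler_wpM2l (T0 k)).
have dn : (a%:R + k%:R + 1) * (b'%:R + k%:R + 1) - (b%:R - k%:R) * (a'%:R - k%:R) <=
    k.+1%:R * (3 * L) :> R.
  have p1 : 0 <= (k%:R + 1) * (L - 1) :> R.
    by apply: mulr_ge0; [exact: addr_ge0|rewrite subr_ge0].
  have p2 : 0 <= k%:R * a%:R :> R by rewrite mulr_ge0.
  have p3 : 0 <= k%:R * b%:R :> R by rewrite mulr_ge0.
  have p4 : 0 <= k%:R * a'%:R :> R by rewrite mulr_ge0.
  have p5 : 0 <= k%:R * b'%:R :> R by rewrite mulr_ge0.
  by rewrite k1; rewrite LE in p1 *; nra.
set den := (_ + _ + 1) * (_ + _ + 1) in dn den0 *.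
set num := (_ - _) * (_ - _) in dn *.
have [nd|nd] := leP den num.
  apply: le_trans nd; rewrite ler_piMl ?(ltW den0)// gerBl divr_ge0 ?(ltW lR)// mulr_ge0 ?(ltW D0)//.
have num4 : c ^+ 2 * l * L / 8 <= num.
  have h1 : c * l / 2 <= b%:R - k%:R by lra.
  have h2 : c * L / 4 <= a'%:R - k%:R by lra.
  have -> : c ^+ 2 * l * L / 8 = (c * l / 2) * (c * L / 4) by field.
  by apply: ler_pM => //; rewrite divr_ge0 ?mulr_ge0 ?(ltW c0) ?(ltW lR) ?(ltW LR).
have : k.+1%:R * (3 * L) <= k.+1%:R * D / l * den.
  rewrite -!mulrA ler_wpM2l//.
  apply: (@le_trans _ _ (D * (l^-1 * (c ^+ 2 * l * L / 8)))).
    rewrite DE0 le_eqVlt; apply/orP; left; apply/eqP; field.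
    by rewrite !gt_eqF.
  rewrite ler_wpM2l ?(ltW D0)// ler_wpM2l ?invr_ge0 ?(ltW lR)//.
  by rewrite (le_trans num4)// ltW.
by rewrite mulrBl mul1r; lra.
Qed.

Lemma Vandermonde_segment (a b a' b' K : nat) : (K <= a')%N ->
  (\sum_(k < K.+1) 'C(a + b, a + k) * 'C(a' + b', a' - k) <=
    'C(a + b + (a' + b'), a + a'))%N.
Proof.
move=> Ka'; rewrite -(binomial.Vandermonde (a + b) (a' + b') (a + a')).
rewrite -(big_mkord xpredT (fun k => 'C(a + b, a + k) * 'C(a' + b', a' - k))%N).
rewrite -(big_mkord xpredT (fun j => 'C(a + b, j) * 'C(a' + b', a + a' - j))%N).
have aK : (a + K.+1 <= (a + a').+1)%N by rewrite -addnS leq_add2l ltnS.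
rewrite [leqRHS](big_cat_nat (n := a)) ?(leq_trans (leq_addr _ _) aK)//=.
rewrite [X in (_ <= _ + X)%N](big_cat_nat (n := (a + K.+1)%N)) ?leq_addr//=.
set s := (\sum_(a <= i < a + K.+1) _)%N.
rewrite (_ : (\sum_(0 <= k < K.+1) _ = s)%N); first by rewrite addnCA leq_addr.
rewrite /s; have := big_addn 0 (a + K.+1) a xpredT
  (fun i => 'C(a + b, i) * 'C(a' + b', a + a' - i))%N.
rewrite add0n addKn => ->; apply: eq_bigr => k _.
by rewrite [(k + a)%N]addnC subnDl.
Qed.

(* Moving k points off the fuller side changes the product of binomials by a factor
   1 - O(k^2 / l), so about sqrt l of the terms of Vandermonde's sum are comparable
   to the given one. *)
Lemma bin_spread (R : realType) (c : R) (a b a' b' : nat) :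
  let l := (a + b)%N in let L := (a + b + (a' + b'))%N in
  0 < c <= 1 -> c * L%:R <= (a + a')%:R -> c * L%:R <= (b + b')%:R ->
  (2 * l <= L)%N -> (0 < l)%N -> (a * b' <= b * a')%N ->
  ('C(a + b, a) * 'C(a' + b', a'))%:R <=
    14 / c / Num.sqrt l%:R * 'C(L, a + a')%:R :> R.
Proof.
move=> l L; have el : l = (a + b)%N by [].
have eL : L = (a + b + (a' + b'))%N by [].
clearbody l L; move=> /andP[c0 c1] cm cm' lL l0 aba.
have lR : 0 < l%:R :> R by rewrite ltr0n.
have LE : L%:R = a%:R + b%:R + a'%:R + b'%:R :> R by rewrite eL !natrD; ring.
have lE : l%:R = a%:R + b%:R :> R by rewrite el natrD.
have abaR : a%:R * b'%:R <= b%:R * a'%:R :> R by rewrite -!natrM ler_nat.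
have lLR : 2 * l%:R <= L%:R :> R by rewrite -natrM ler_nat.
have LR : 0 < L%:R :> R by lra.
rewrite [(a + a')%:R]natrD in cm; rewrite [(b + b')%:R]natrD in cm'.
have a0 : 0 <= a%:R :> R by []. have b0 : 0 <= b%:R :> R by [].
have a'0 : 0 <= a'%:R :> R by []. have b'0 : 0 <= b'%:R :> R by [].
(* By [aba] the first block is no richer in a than the whole: b is at least the share l (b + b') /
   L, and a at most l (a + a') / L, hence at most half of a + a'. *)
have bl : c * l%:R <= b%:R.
  rewrite -(ler_pM2r LR); apply: (@le_trans _ _ (l%:R * (b%:R + b'%:R))).
    by rewrite mulrAC mulrC ler_wpM2l// ltW.
  by rewrite lE LE; nra.
have a'L : c * L%:R / 2 <= a'%:R.
  have : a%:R * L%:R <= l%:R * (a%:R + a'%:R) :> R by rewrite lE LE; nra.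
  move=> h; have h2 : a%:R <= (a%:R + a'%:R) / 2 :> R.
    by rewrite -(ler_pM2r LR); nra.
  lra.
pose D := 24 / c ^+ 2; have DE0 : D = 24 / c ^+ 2 by [].
have c20 : 0 < c ^+ 2 by rewrite exprn_gt0.
have D0 : 0 < D by rewrite DE0 divr_gt0.
(* K is the largest shift with K^2 D / l <= 1 / 2, so that each of the first K + 1 terms is at least
   half of T 0. *)
clearbody D; pose K := truncn (Num.sqrt (l%:R / (2 * D))).
have K1 : K%:R <= Num.sqrt (l%:R / (2 * D)) by rewrite /K truncn_le// sqrtr_ge0.
have K2 : Num.sqrt (l%:R / (2 * D)) < K.+1%:R by exact: truncnS_gt.
clearbody K.
have KD : K%:R ^+ 2 * D <= l%:R / 2.
  have : K%:R ^+ 2 <= l%:R / (2 * D).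
    rewrite -[leRHS]sqr_sqrtr; first by rewrite lerXn2r ?nnegrE ?sqrtr_ge0.
    by apply: divr_ge0; [exact: ltW lR|lra].
  by rewrite invfM mulrA ler_pdivlMr.
have Kb : 2 * K%:R <= c * l%:R.
  have cl0 : 0 <= c * l%:R := mulr_ge0 (ltW c0) (ltW lR).
  rewrite -(@ler_pXn2r _ 2) ?nnegrE// exprMn.
  have l1 : 1 <= l%:R :> R by rewrite ler1n.
  have DE : D * c ^+ 2 = 24 by rewrite DE0 divfK// gt_eqF.
  have h : K%:R ^+ 2 * 24 <= l%:R / 2 * c ^+ 2.
    by rewrite -DE mulrA ler_wpM2r// ltW.
  have h2 : l%:R * c ^+ 2 <= l%:R ^+ 2 * c ^+ 2.
    by rewrite ler_wpM2r ?(ltW c20)// expr2 ler_peMl// ltW.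
  have h3 : 0 <= l%:R ^+ 2 * c ^+ 2 by rewrite mulr_ge0 ?sqr_ge0.
  by rewrite [leRHS]exprMn; lra.
have L1 : 1 <= L%:R :> R by rewrite ler1n -(ltr0n R).
pose T k := ('C(a + b, a + k) * 'C(a' + b', a' - k))%:R : R.
have T0 k : 0 <= T k by [].
have step k : (k < K)%N -> T k * (1 - k.+1%:R * D / l%:R) <= T k.+1.
  move=> kK; rewrite DE0 el; rewrite el in Kb lR bl lLR; rewrite eL in L1 a'L lLR.
  apply: (bin_spread_step c0 bl a'L lLR lR L1 aba).
  by apply: le_trans Kb; rewrite ler_wpM2l// ler_nat.
have [x xE] : exists x, x = D / l%:R by exists (D / l%:R).
have x0 : 0 <= x by rewrite xE divr_ge0 ?(ltW D0) ?(ltW lR).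
have step' k : (k < K)%N -> T k * (1 - k.+1%:R * x) <= T k.+1.
  by move=> /step; rewrite xE mulrA.
have kD2 k : (k <= K)%N -> k%:R ^+ 2 * x <= 2^-1.
  move=> kK; rewrite xE mulrA ler_pdivrMr// [leRHS]mulrC; apply: le_trans KD.
  by rewrite ler_wpM2r ?(ltW D0)// lerXn2r ?nnegrE// ler_nat.
have Tk k : (k <= K)%N -> T 0%N * (1 - k%:R ^+ 2 * x) <= T k.
  elim: k => [_|k ih kK]; first by rewrite expr0n !mul0r subr0 mulr1.
  apply: le_trans (step' k kK).
  have y1 : 0 <= 1 - k.+1%:R * x.
    rewrite subr_ge0; apply: (@le_trans _ _ 2^-1); last by lra.
    apply: le_trans _ (kD2 _ kK); rewrite ler_wpM2r//.
    by rewrite expr2 ler_peMr// ler1n.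
  apply: le_trans (ler_wpM2r y1 (ih (ltnW kK))).
  rewrite -[leRHS]mulrA; apply: (ler_wpM2l (T0 _)).
  have -> : k.+1%:R = k%:R + 1 :> R by rewrite -natr1.
  have k0 : 0 <= k%:R :> R by [].
  have p1 : 0 <= k%:R * x by rewrite mulr_ge0.
  have p2 : 0 <= (k%:R ^+ 2 * x) * ((k%:R + 1) * x).
    by rewrite !mulr_ge0 ?addr_ge0 ?sqr_ge0.
  rewrite -subr_ge0; have -> : (1 - k%:R ^+ 2 * x) * (1 - (k%:R + 1) * x) - (1 - (k%:R + 1) ^+ 2 * x) =
    k%:R * x + (k%:R ^+ 2 * x) * ((k%:R + 1) * x) by ring.
  exact: addr_ge0.
have TK k : (k <= K)%N -> T 0%N / 2 <= T k.
  move=> kK; apply: le_trans (Tk _ kK); rewrite ler_wpM2l//.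
  by have := kD2 _ kK; lra.
have Ka' : (K <= a')%N.
  have : c * l%:R <= c * (L%:R / 2) by rewrite ler_wpM2l ?(ltW c0)//; lra.
  by rewrite -(ler_nat R); have := ler0n R K; lra.
have Vm : \sum_(k < K.+1) T k <= 'C(L, a + a')%:R.
  by rewrite /T -natr_sum ler_nat eL Vandermonde_segment.
have hT : K.+1%:R * (T 0%N / 2) <= 'C(L, a + a')%:R.
  apply: le_trans Vm; rewrite -[K.+1 in leLHS]card_ord -sum1_card natr_sum mulr_suml.
  by apply: ler_sum => k _; rewrite mul1r TK// -ltnS.
have sl : 0 < Num.sqrt l%:R :> R by rewrite sqrtr_gt0.
(* Here l / (2 D) = c^2 l / 48, and 48 < 7^2. Together with the lost half this gives 14 = 2 times
   7. *)
have cK : c * Num.sqrt l%:R / 7 <= K.+1%:R.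
  apply: le_trans (ltW K2).
  have cs0 : 0 <= c * Num.sqrt l%:R / 7 by rewrite divr_ge0// mulr_ge0 ?(ltW c0) ?(ltW sl).
  rewrite -[leLHS]ger0_norm// -sqrtr_sqr ler_wsqrtr//.
  rewrite !exprMn sqr_sqrtr ?(ltW lR)// DE0 invfM invf_div.
  have : 0 <= c ^+ 2 * l%:R := mulr_ge0 (ltW c20) (ltW lR).
  have -> : l%:R * (2^-1 * (c ^+ 2 / 24)) = c ^+ 2 * l%:R / 48 by field.
  by rewrite exprVn; lra.
have TE : ('C(a + b, a) * 'C(a' + b', a'))%:R = T 0%N by rewrite /T addn0 subn0.
rewrite TE.
have cs0 : 0 < c * Num.sqrt l%:R by rewrite mulr_gt0.
have -> : 14 / c / Num.sqrt l%:R * 'C(L, a + a')%:R = 14 * 'C(L, a + a')%:R / (c * Num.sqrt l%:R).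
  by rewrite invfM; ring.
rewrite ler_pdivlMr//.
have := le_trans (ler_wpM2r (_ : 0 <= T 0%N / 2) cK) hT; rewrite divr_ge0// => /(_ isT) h.
have -> : T 0%N * (c * Num.sqrt l%:R) = 14 * (c * Num.sqrt l%:R / 7 * (T 0%N / 2)) by field.
by rewrite ler_wpM2l.
Qed.

(** Exchanging the two kinds of steps reduces to the case a b' <= b a'. Passing from l to l + 1
    under the root, which admits l = 0, raises 14 to 20, since 14^2 times 2 is below 20^2. *)
Lemma bin_spread_early (R : realType) (c : R) (a b a' b' : nat) :
  0 < c <= 1 -> c * (a + b + (a' + b'))%:R <= (a + a')%:R ->
  c * (a + b + (a' + b'))%:R <= (b + b')%:R ->
  (2 * (a + b) <= a + b + (a' + b'))%N ->
  ('C(a + b, a) * 'C(a' + b', a'))%:R <=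
    20 / c / Num.sqrt (a + b).+1%:R * 'C(a + b + (a' + b'), a + a')%:R :> R.
Proof.
move=> c01 cm cm' lL; have /andP[c0 c1] := c01.
have [l0|l0] := posnP (a + b)%N.
  move: l0 => /eqP; rewrite addn_eq0 => /andP[/eqP -> /eqP ->].
  rewrite !add0n bin0 mul1n sqrtr1 divr1 ler_peMl// ler_pdivlMr// mul1r.
  by apply: le_trans c1 _; rewrite ler1n.
have spread : ('C(a + b, a) * 'C(a' + b', a'))%:R <=
    14 / c / Num.sqrt (a + b)%:R * 'C(a + b + (a' + b'), a + a')%:R :> R.
  have [aba|/ltnW aba] := leqP (a * b') (b * a'); first exact: bin_spread.
  have := @bin_spread R c b a b' a'; rewrite ![(b + a)%N]addnC ![(b' + a')%N]addnC.
  move=> /(_ c01 cm' cm lL l0 aba).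
  have sw x y : 'C(x + y, y) = 'C(x + y, x) by rewrite -bin_sub ?leq_addl// addnK.
  rewrite !sw (_ : 'C(_, b + b') = 'C(a + b + (a' + b'), a + a'))//.
  by rewrite addnACA sw.
apply: le_trans spread _; rewrite ler_wpM2r// -!mulrA [_^-1 * _]mulrC [X in _ <= _ * X]mulrC !mulrA.
rewrite ler_wpM2r ?invr_ge0 ?(ltW c0)//.
have s0 : 0 < Num.sqrt (a + b)%:R :> R by rewrite sqrtr_gt0 ltr0n.
have s1 : 0 < Num.sqrt (a + b).+1%:R :> R by rewrite sqrtr_gt0 ltr0n.
rewrite ler_pdivrMr// mulrAC ler_pdivlMr//.
rewrite -(@ler_pXn2r _ 2) ?nnegrE ?mulr_ge0 ?sqrtr_ge0// !exprMn !sqr_sqrtr//.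
have l1 : 1 <= (a + b)%:R :> R by rewrite ler1n.
by rewrite -natr1; lra.
Qed.

(** The quotient is the probability that a uniform path passes through a given point. A point in the
    second half is treated by reversing the path, which exchanges the two blocks. *)
Lemma bin_ratio_bound (R : realType) (c : R) (a b a' b' : nat) :
  0 < c <= 1 -> c * (a + b + (a' + b'))%:R <= (a + a')%:R ->
  c * (a + b + (a' + b'))%:R <= (b + b')%:R ->
  ('C(a + b, a) * 'C(a' + b', a'))%:R / 'C(a + b + (a' + b'), a + a')%:R <=
    20 / c * ((Num.sqrt (a + b).+1%:R)^-1 + (Num.sqrt (a' + b').+1%:R)^-1) :> R.
Proof.
move=> c01 cm cm'; have /andP[c0 c1] := c01.
have C0 : 0 < 'C(a + b + (a' + b'), a + a')%:R :> R.
  by rewrite ltr0n bin_gt0 addnACA leq_addr.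
rewrite ler_pdivrMr// mulrDr mulrDl.
have i0 n : 0 <= 20 / c * (Num.sqrt n.+1%:R)^-1 * 'C(a + b + (a' + b'), a + a')%:R :> R.
  by rewrite !mulr_ge0 ?invr_ge0 ?sqrtr_ge0// ltW.
have [lL|lL] := leqP (2 * (a + b)) (a + b + (a' + b')).
  by apply: le_trans (bin_spread_early c01 cm cm' lL) _; rewrite lerDl.
have := @bin_spread_early R c a' b' a b c01.
rewrite [(a' + b' + _)%N]addnC [(a' + a)%N]addnC [(b' + b)%N]addnC => /(_ cm cm').
rewrite [('C(a' + b', a') * _)%N]mulnC => h; apply: le_trans (h _) _; last by rewrite lerDr.
by move: lL; rewrite !mul2n -!addnn ltn_add2l leq_add2r; exact: ltnW.
Qed.

Lemma sum_inv_sqrt (R : realType) (n : nat) :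
  \sum_(k < n) (Num.sqrt k.+1%:R)^-1 <= 2 * Num.sqrt n%:R :> R.
Proof.
elim: n => [|n ih]; first by rewrite big_ord0 sqrtr0 mulr0.
rewrite big_ord_recr /=; apply: le_trans (lerD ih (lexx _)) _.
have s1 : 0 < Num.sqrt n.+1%:R :> R by rewrite sqrtr_gt0 ltr0n.
have s0 : 0 <= Num.sqrt n%:R :> R by rewrite sqrtr_ge0.
have e1 : Num.sqrt n.+1%:R ^+ 2 = Num.sqrt n%:R ^+ 2 + 1 :> R.
  by rewrite !sqr_sqrtr// natr1.
rewrite -(ler_pM2r s1) mulrDl mulVf ?gt_eqF//.
move: (Num.sqrt n.+1%:R) (Num.sqrt n%:R) s1 s0 e1 => u v u0 v0 e.
have : 0 <= (u - v) ^+ 2 by rewrite sqr_ge0.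
by rewrite !expr2 in e *; nra.
Qed.

(** * Lattice paths *)

(** Paths are coded by their steps, [true] for a step in the first coordinate. The enumeration
    follows Pascal's recursion, so its length is a binomial coefficient by induction. *)
Fixpoint bit_words (L m : nat) : seq bitseq :=
  if L is L'.+1 then
    map (cons false) (bit_words L' m) ++
    (if m is m'.+1 then map (cons true) (bit_words L' m') else [::])
  else if m is 0%N then [:: [::]] else [::].

Lemma mem_bit_words L m t : (t \in bit_words L m) = (size t == L) && (count id t == m).
Proof.
elim: L m t => [|L ih] [|m] [|b t] //=.
- by apply/negbTE; rewrite cats0; apply/mapP => -[].
- rewrite cats0; case: b => /=.
    by rewrite andbF; apply/mapP => -[].
  by rewrite mem_map ?ih ?add0n ?eqSS// => x y [].
- by rewrite mem_cat; apply/negbTE; rewrite negb_or; apply/andP; split; apply/mapP => -[].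
- rewrite mem_cat; case: b => /=.
    rewrite [X in _ || X]mem_map; last by move=> x y [].
    by rewrite ih add1n !eqSS orb_idl// => /mapP[].
  rewrite mem_map; last by move=> x y [].
  by rewrite ih add0n eqSS orb_idr// => /mapP[].
Qed.

Lemma bit_words_uniq L m : uniq (bit_words L m).
Proof.
elim: L m => [|L ih] [|m] //=.
  by rewrite cats0 map_inj_uniq// => x y [].
rewrite cat_uniq !map_inj_uniq ?ih//=; last 2 first.
- by move=> x y [].
- by move=> x y [].
by rewrite andbT; apply/hasPn => _ /mapP[x _ ->]; apply/negP => /mapP[].
Qed.

Lemma size_bit_words L m : size (bit_words L m) = 'C(L, m).
Proof.
elim: L m => [|L ih] [|m] //=; first by rewrite cats0 size_map ih !bin0.
by rewrite size_cat !size_map !ih binS addnC.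
Qed.

(** The first [l] letters and the remaining ones are chosen separately. Without [a <= m] the
    truncated difference [m - a] would give a nonzero product although no word qualifies. *)
Lemma count_bit_words_prefix l L m a : (a <= m)%N ->
  count (fun t => count id (take l t) == a) (bit_words (l + L) m) =
  ('C(l, a) * 'C(L, m - a))%N.
Proof.
elim: l m a => [|l ih] m a am.
  under eq_count do rewrite take0 /=.
  case: a am => [|a] am; first by rewrite bin0 mul1n subn0 -size_bit_words count_predT.
  by rewrite bin0n mul0n; under eq_count do rewrite eq_sym /=; rewrite count_pred0.
rewrite addSn /= count_cat count_map /=.
under eq_count do rewrite /= add0n.
rewrite ih//; case: m am => [|m] am.
  by move: am; rewrite leqn0 => /eqP ->; rewrite addn0 !bin0.
rewrite count_map.
case: a am => [|a] am.
  by under [X in (_ + X)%N]eq_count do rewrite /=; rewrite count_pred0 addn0 !bin0.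
under [X in (_ + X)%N]eq_count do rewrite /= add1n eqSS.
by rewrite ih// binS mulnDl subSS.
Qed.

Definition walk_step (v : nat * nat) (b : bool) : nat * nat :=
  if b then (v.1.+1, v.2) else (v.1, v.2.+1).

Definition walk (u : nat * nat) (t : bitseq) : seq (nat * nat) := u :: scanl walk_step u t.

Lemma size_walk u t : size (walk u t) = (size t).+1.
Proof. by rewrite /= size_scanl. Qed.

Lemma walk_inj u : injective (walk u).
Proof.
move=> t t'; rewrite /walk => -[]; elim: t t' u => [|b t ih] [|b' t'] u //=.
case: u => x y; case: b; case: b' => /= e.
- by congr (_ :: _); apply: (ih _ (x.+1, y)); case: e.
- by case: e => h; exfalso; move: h; lia.
- by case: e => h; exfalso; move: h; lia.
- by congr (_ :: _); apply: (ih _ (x, y.+1)); case: e.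
Qed.

(** The coordinate sum grows by one at each step; hence the points of a walk are distinct and each
    level is met exactly once. *)
Lemma walk_levels u t :
  map (fun v : nat * nat => (v.1 + v.2)%N) (walk u t) = iota (u.1 + u.2) (size t).+1.
Proof.
elim: t u => [//|b t ih] u.
transitivity ((u.1 + u.2)%N :: map (fun v : nat * nat => (v.1 + v.2)%N) (walk (walk_step u b) t)).
  by [].
by rewrite ih; case: b => /=; rewrite ?addSn ?addnS.
Qed.

Lemma walk_uniq u t : uniq (walk u t).
Proof. by apply: (@map_uniq _ _ (fun v => v.1 + v.2)%N); rewrite walk_levels iota_uniq. Qed.

Lemma last_walk u t : last u (scanl walk_step u t) =
  (u.1 + count id t, u.2 + count negb t)%N.
Proof.
elim: t u => [|b t ih] u /=; first by case: u => x y; rewrite !addn0.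
by rewrite ih; case: b => /=; rewrite ?add0n ?add1n ?addSn ?addnS.
Qed.

Lemma mem_walk u t v : v \in walk u t ->
  exists k, v = (u.1 + count id (take k t), u.2 + count negb (take k t))%N.
Proof.
elim: t u => [|b t ih] u.
  by rewrite inE => /eqP ->; exists 0%N; case: u => x y; rewrite /= !addn0.
rewrite /walk inE => /orP[/eqP ->|]; first by exists 0%N; case: u => x y; rewrite /= !addn0.
rewrite /= -/(walk _ t) => /ih[k ->]; exists k.+1.
by case: b => /=; rewrite ?add0n ?add1n ?addSn ?addnS.
Qed.

Lemma walk_path u t : path up_right_step u (scanl walk_step u t).
Proof.
elim: t u => [//|b t ih] u /=; rewrite ih andbT.
by case: b; rewrite /up_right_step /walk_step eqxx ?orbT.
Qed.

Lemma path_walk u s : path up_right_step u s -> exists t, s = scanl walk_step u t.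
Proof.
elim: s u => [u _|v s ih u /= /andP[uv /ih[t ->]]]; first by exists [::].
case/orP: uv => /eqP ->; first by exists (true :: t).
by exists (false :: t).
Qed.

(** The arguments count steps, not points: M steps right and N steps up lead from (1, 1) to (M + 1,
    N + 1). *)
Definition lattice_walks (M N : nat) : seq (seq (nat * nat)) :=
  map (walk (1, 1)%N) (bit_words (M + N) M).

Lemma lattice_walksP M N (s : lattice_path) :
  up_right_paths M.+1 N.+1 s <-> s \in lattice_walks M N.
Proof.
split.
  case: s => [|u s]; first by case.
  case=> /= sz -> sl sp; rewrite addSn addnS subn1 /= in sz.
  have [t st] := path_walk sp.
  move: sl; rewrite st last_walk /= !add1n => -[tM tN].
  apply/mapP; exists t => //; rewrite mem_bit_words tM eqxx andbT.
  by move: sz; rewrite st size_scanl => -[->].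
move=> /mapP[t]; rewrite mem_bit_words => /andP[/eqP sz /eqP tM] ->; split.
- by rewrite size_walk sz addSn addnS subn1.
- by [].
- rewrite /= last_walk /= tM !add1n; congr (_, _.+1).
  by have := count_predC id t; rewrite tM sz => /addnI.
- exact: walk_path.
Qed.

Lemma lattice_walks_uniq M N : uniq (lattice_walks M N).
Proof. by rewrite map_inj_uniq ?bit_words_uniq//; exact: walk_inj. Qed.

Lemma lattice_walks_neq0 M N : lattice_walks M N != [::].
Proof.
by rewrite -size_eq0 size_map size_bit_words -lt0n bin_gt0 leq_addr.
Qed.

Definition rectangle (M N : nat) : seq (nat * nat) :=
  [seq (i, j) | i <- iota 1 M.+1, j <- iota 1 N.+1].

Lemma rectangle_uniq M N : uniq (rectangle M N).
Proof.
by apply: allpairs_uniq; rewrite ?iota_uniq// => -[? ?] [? ?] _ _ /=.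
Qed.

Lemma mem_rectangle M N v : (v \in rectangle M N) =
  (1 <= v.1 <= M.+1)%N && (1 <= v.2 <= N.+1)%N.
Proof.
case: v => i j; apply/allpairsP/idP.
  by move=> [[x y] []]; rewrite !mem_iota => /= ? ? [-> ->]; apply/andP.
move=> /andP[hi hj]; exists (i, j); by split => //; rewrite mem_iota.
Qed.

Lemma lattice_walks_spec M N : {in lattice_walks M N, forall s,
  [/\ uniq s, {subset s <= rectangle M N} & size s = (M + N).+1]}.
Proof.
move=> s sS; split.
- by move: sS => /mapP[t _ ->]; exact: walk_uniq.
- move=> v vs; rewrite mem_rectangle.
  have /lattice_walksP/up_right_paths_square := sS.
  by move=> /(_ v vs).
- move: sS => /mapP[t]; rewrite mem_bit_words => /andP[/eqP sz _] ->.
  by rewrite size_walk sz.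
Qed.

(** A walk through the point has exactly [a] letters [true] among its first [a + b] steps. Only this
    implication is needed for an upper bound. *)
Lemma hit_prob_lattice (R : realType) M N a b : (a <= M)%N -> (b <= N)%N ->
  hit_prob R (lattice_walks M N) (a.+1, b.+1) <=
  ('C(a + b, a) * 'C(M - a + (N - b), M - a))%:R / 'C(M + N, M)%:R.
Proof.
move=> aM bN; rewrite /hit_prob /path_avg big_map size_map size_bit_words mulrC.
rewrite ler_wpM2r ?invr_ge0// -natr_sum ler_nat.
have -> : (M - a + (N - b) = M + N - (a + b))%N by lia.
rewrite -count_bit_words_prefix// subnKC ?leq_add//.
rewrite -sum1_count [leqRHS]big_mkcond; apply: leq_sum => t _.
have [/mem_walk[k]|//] := boolP (_ \in _).
rewrite /= !add1n => -[ka kb].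
(* The index k may exceed the length of t, but the size of [take k t] is a + b in every case. *)
have -> : (a + b)%N = size (take k t) by rewrite -(count_predC id) -ka kb.
rewrite [take (size _) t](_ : _ = take k t); first by rewrite -ka eqxx.
by rewrite size_take; case: ltnP => // tk; rewrite take_size take_oversize.
Qed.

(* One factor hit_prob is bounded by a function of the level i + j alone; since a path
   meets each level once, the sum against the other factor is a sum over levels. *)
Lemma sum_hit_prob_sq (R : realType) (c : R) M N : 0 < c <= 1 ->
  c * (M + N)%:R <= M%:R -> c * (M + N)%:R <= N%:R ->
  \sum_(v <- rectangle M N) hit_prob R (lattice_walks M N) v ^+ 2 <=
    80 / c * Num.sqrt (M + N).+1%:R.
Proof.
move=> c01 cM cN; have /andP[c0 _] := c01; set S := lattice_walks M N; set L := (M + N)%N.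
pose B (l : nat) : R := 20 / c * ((Num.sqrt l.+1%:R)^-1 + (Num.sqrt (L - l).+1%:R)^-1).
pose lev (v : nat * nat) := (v.1 + v.2 - 2)%N.
have pB v : v \in rectangle M N -> hit_prob R S v <= B (lev v).
  rewrite mem_rectangle; case: v => [[|a] [|b]]; rewrite ?andbF//= !ltnS => /andP[aM bN].
  apply: le_trans (hit_prob_lattice R aM bN) _.
  have ML : (a + b + (M - a + (N - b)) = M + N)%N by lia.
  have Ma : (a + (M - a) = M)%N by lia.
  have Nb : (b + (N - b) = N)%N by lia.
  have := @bin_ratio_bound R c a b (M - a) (N - b) c01.
  rewrite ML Ma Nb => /(_ cM cN) h; apply: le_trans h _.
  have -> : lev (a.+1, b.+1) = (a + b)%N by rewrite /lev /=; lia.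
  have -> : (M - a + (N - b) = L - (a + b))%N by rewrite /L; lia.
  exact: lexx.
apply: (@le_trans _ _ (\sum_(v <- rectangle M N) hit_prob R S v * B (lev v))).
  rewrite big_seq [leRHS]big_seq; apply: ler_sum => v vR.
  by rewrite expr2 ler_wpM2l ?hit_prob_ge0// pB.
rewrite /hit_prob; under eq_bigr do rewrite -path_avgZr.
rewrite -path_avg_sum (@path_avg_eq _ _ _ _ (fun=> \sum_(l < L.+1) B l)).
  rewrite path_avg_cst ?lattice_walks_neq0// /B -mulr_sumr big_split /=.
  have -> : 80 / c * Num.sqrt L.+1%:R = 20 / c * (2 * Num.sqrt L.+1%:R + 2 * Num.sqrt L.+1%:R).
    by ring.
  rewrite ler_wpM2l ?divr_ge0 ?(ltW c0)// lerD ?sum_inv_sqrt//.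
  apply: le_trans (sum_inv_sqrt R L.+1); rewrite (reindex_inj rev_ord_inj) /=.
  by rewrite le_eqVlt; apply/orP; left; apply/eqP; apply: eq_bigr => l _; rewrite subKn// -ltnS.
move=> s sS; have [us sR sz] := lattice_walks_spec sS.
transitivity (\sum_(v <- s) B (lev v)).
  under eq_bigr do rewrite mulr_natl mulrb.
  rewrite -big_mkcond /= -big_filter; apply: perm_big; apply: uniq_perm => //.
    by rewrite filter_uniq ?rectangle_uniq.
  by move=> v; rewrite mem_filter andb_idr// => /sR.
move: sS => /mapP[t]; rewrite mem_bit_words => /andP[/eqP st _] ->.
rewrite -(big_mkord xpredT) -(big_map (fun v : nat * nat => (v.1 + v.2)%N) xpredT (fun k => B (k - 2)%N)).
rewrite walk_levels st -/L /index_iota subn0.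
have -> : iota ((1, 1)%N.1 + (1, 1)%N.2) L.+1 = map (addn 2) (iota 0 L.+1) by rewrite -iotaDl.
rewrite big_map.
by apply: eq_bigr => k _; rewrite addKn.
Qed.

(** * Almost sure convergence *)

(** The sum of the eighth powers has a finite integral, so it is finite almost everywhere and its
    terms tend to 0. *)
Lemma ae_cvg0_of_moment8 d (T : measurableType d) (R : realType) (P : probability T R)
    (A : nat -> T -> R) (B : R) (N0 : nat) :
  (forall n, (N0 <= n)%N -> measurable_fun setT (A n)) ->
  (forall n, (N0 <= n)%N -> (\int[P]_x (A n x ^+ 8)%:E <= (B * n%:R^-1 ^+ 2)%:E)%E) ->
  {ae P, forall x, A n x @[n --> \oo] --> (0 : R)}.
Proof.
(* The shift by [N0.+1] avoids the index 0, at which [n%:R^-1] is 0 by convention. *)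
move=> mA A8; pose N1 := N0.+1; pose F n x := (A (n + N1)%N x ^+ 8)%:E.
have N1n n : (N0 <= n + N1)%N by rewrite /N1; lia.
have F0 n x : (0 <= F n x)%E by rewrite lee_fin exprn_even_ge0.
have mF n : measurable_fun setT (F n).
  by apply/measurable_EFinP; apply: measurable_funX; exact: mA.
have B0 : 0 <= B.
  have := A8 _ (N1n 0%N) => /(le_trans (integral_ge0 _ (fun x _ => F0 0%N x))).
  by rewrite lee_fin pmulr_lge0// exprn_gt0// invr_gt0 ltr0n.
(* Telescoping comparison: 1 / (k + 1)^2 is at most 2 (1 / (k + 1) - 1 / (k + 2)). *)
have tel k : \sum_(0 <= n < k) (B * (n + N1)%:R^-1 ^+ 2) <= 2 * B.
  rewrite -mulr_sumr mulrC ler_wpM2r//.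
  apply: (@le_trans _ _ (2 * (1 - k.+1%:R^-1))); last first.
    by rewrite ler_piMr// gerBl invr_ge0.
  elim: k => [|k ih]; first by rewrite big_geq// invr1 subrr mulr0.
  rewrite big_nat_recr//= (le_trans (lerD ih (_ : _ <= 2 * (k.+1%:R^-1 - k.+2%:R^-1))))//.
    rewrite (@le_trans _ _ (k.+1%:R^-1 ^+ 2))//.
      rewrite lerXn2r ?nnegrE ?invr_ge0// lef_pV2 ?posrE ?ltr0n ?ler_nat//.
        by rewrite /N1; lia.
      by rewrite /N1; lia.
    have k0 : 0 < k.+1%:R :> R by rewrite ltr0n.
    have -> : k.+2%:R = k.+1%:R + 1 :> R by rewrite -natr1.
    have k1 : 1 <= k.+1%:R :> R by rewrite ler1n.
    move: (k.+1%:R : R) k0 k1 => a a0 a1.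
    have -> : 2 * (a^-1 - (a + 1)^-1) = a^-1 ^+ 2 * (2 * a / (a + 1)) by field; lra.
    by rewrite ler_peMr ?exprn_ge0 ?invr_ge0 ?(ltW a0)// ler_pdivlMr; lra.
  by rewrite -mulrDr addrA subrK.
have sF : (\int[P]_x (\sum_(0 <= n <oo) F n x) <= (2 * B)%:E)%E.
  rewrite integral_nneseries//.
  apply: lime_le.
    by apply: is_cvg_nneseries => n _ _; exact: integral_ge0.
  apply: nearW => k; apply: le_trans (_ : (\sum_(0 <= n < k) (B * (n + N1)%:R^-1 ^+ 2)%:E <= _)%E).
    by apply: lee_sum => n _; exact: A8.
  by rewrite sumEFin lee_fin.
have iF : P.-integrable setT (fun x => \sum_(0 <= n <oo) F n x)%E.
  apply/integrableP; split.
    exact: (ge0_emeasurable_sum (P := xpredT)).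
  under eq_integral do rewrite gee0_abs ?nneseries_ge0//.
  by rewrite (le_lt_trans sF)// ltry.
have := integrable_ae measurableT iF; apply: filterS => x /(_ I) fx.
rewrite -(cvg_shiftn N1).
have c8 : (fun n => A (n + N1)%N x ^+ 8) @ \oo --> (0 : R).
  apply: cvg_series_cvg_0; apply: nondecreasing_is_cvgn.
    by apply: nondecreasing_series => n _ _; exact: exprn_even_ge0.
  exists (fine (\sum_(0 <= n <oo) F n x)%E) => _ [k _ <-].
  rewrite -lee_fin fineK// /series /= -sumEFin.
  by apply: nneseries_lim_ge => n _ _; exact: F0.
apply/cvgrPdist_lt => e e0.
have /cvgrPdist_lt/(_ (e ^+ 8)) := c8; rewrite exprn_gt0// => /(_ isT).
apply: filterS => n /=; rewrite !sub0r !normrN normrX.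
by rewrite ltr_pXn2r ?nnegrE ?(ltW e0).
Qed.

(** The measure vanishes off the finite set of paths, so [g] may be replaced by a finite combination
    of indicators of single paths, all of the same mass. *)
Lemma Rintegral_uniform_on (R : realType) M N (g : lattice_path -> R) :
  \int[uniform_on R (up_right_paths M.+1 N.+1)]_s g s = path_avg (lattice_walks M N) g.
Proof.
set S := lattice_walks M N; set A := up_right_paths _ _.
have fA : finite_set A := finite_up_right_paths _ _.
have A0 : A !=set0 by exact: up_right_paths_neq0.
have SA : fset_set A =i S.
  move=> s; rewrite in_fset_set//; apply/idP/idP.
    by move=> /set_mem/lattice_walksP.
  by move=> ?; apply/mem_set/lattice_walksP.
have cA : #|` fset_set A| = size S.
  by apply: perm_size; apply: uniq_perm SA => //; exact: lattice_walks_uniq.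
have U1 s : s \in S -> uniform_on R A [set s] = ((size S)%:R^-1)%:E.
  move=> sS; rewrite uniform_onE// cA.
  have -> : [set s] `&` A = [set s].
    by apply/setIidl => _ ->; exact/lattice_walksP.
  by rewrite fset_set1 cardfs1 mul1r.
have U0 : uniform_on R A (~` A) = 0%E.
  by rewrite uniform_onE// setICl fset_set0 cardfs0 mul0r.
pose g' t := \sum_(s <- S) g s * \1_[set s] t.
have gg' s : s \in S -> g s = g' s.
  move=> sS; rewrite /g' (bigD1_seq s)//=; last exact: lattice_walks_uniq.
  rewrite indicE mem_set// mulr1 big1 ?addr0// => t ts.
  by rewrite indicE memNset ?mulr0// => /= st; rewrite st eqxx in ts.
have i1 s : (uniform_on R A).-integrable setT (EFin \o (fun t => g s * \1_[set s] t)).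
  apply: integrable_EFinZ; apply: (@integrable_EFin_bounded _ _ _ _ _ 1) => // t.
  by rewrite indicE ger0_norm// -[leRHS]/(true%:R) ler_nat leq_b1.
transitivity (\int[uniform_on R A]_s g' s).
  rewrite /Rintegral; congr fine; apply: ae_eq_integral => //.
  exists (~` A); split => // s /= h As; apply: h => _.
  by rewrite -gg'//; exact/lattice_walksP.
rewrite /g' Rintegral_sum// /path_avg mulr_sumr big_seq [RHS]big_seq.
apply: eq_bigr => s sS.
rewrite RintegralZl//; last first.
  apply: (@integrable_EFin_bounded _ _ _ _ _ 1) => // t.
  by rewrite indicE ger0_norm// -[leRHS]/(true%:R) ler_nat leq_b1.
by rewrite /Rintegral integral_indic// setIT [X in fine X]U1// mulrC.
Qed.

Lemma Rintegral_distribution d (T : measurableType d) (R : realType) (P : probability T R)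
    (X : {RV P >-> R}) (f : R -> R) (c : R) :
  measurable_fun setT f -> (forall x, `|f x| <= c) ->
  \int[distribution P X]_x f x = \int[P]_x f (X x).
Proof.
move=> mf fc; rewrite /Rintegral; congr fine.
rewrite (@integral_pushforward _ _ _ _ _ X)//; first exact/measurable_EFinP.
apply: (@integrable_EFin_bounded _ _ _ _ _ c) => //.
exact: measurableT_comp.
Qed.

(** (1 + y) / 2 is at most the larger of 1 and y, whose eighth power is at most 1 or y to the power
    p. *)
Lemma pow8_le_powR (R : realType) (C p y : R) : 0 <= C -> 8 <= p -> 0 <= y ->
  (C * (1 + y)) ^+ 8 <= (2 * C) ^+ 8 * (1 + y `^ p).
Proof.
move=> C0 p8 y0.
have -> : (C * (1 + y)) ^+ 8 = (2 * C) ^+ 8 * ((1 + y) / 2) ^+ 8.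
  by rewrite -exprMn; congr (_ ^+ 8); field.
apply: ler_wpM2l; first by rewrite exprn_ge0// mulr_ge0.
have [y1|y1] := leP y 1.
  rewrite (@le_trans _ _ 1)//; last by rewrite lerDl powR_ge0.
  by rewrite exprn_ile1//; lra.
rewrite (@le_trans _ _ (y `^ p))//; last by rewrite lerDr.
rewrite (@le_trans _ _ (y `^ 8))//; last by rewrite ler_powR// ltW.
by rewrite powR_mulrn// lerXn2r ?nnegrE//; lra.
Qed.

(** * The random environment and the test functions *)

Section environment.
Context (R : realType) (xi p K : R) (xi_gt0 : 0 < xi) (p_ge8 : 8 <= p).
Context d (Omega : measurableType d) (Pw : probability Omega R) (w : nat -> nat -> {RV Pw >-> R}).
Hypothesis w_indep : mutually_independent [set ij | (1 <= ij.1)%N /\ (1 <= ij.2)%N]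
  (fun ij : nat * nat => w ij.1 ij.2).
Hypothesis w_mean : forall i j, (1 <= i)%N -> (1 <= j)%N -> ('E_Pw[w i j] = 0)%E.
Hypothesis w_var : forall i j, (1 <= i)%N -> (1 <= j)%N ->
  ('E_Pw[(fun omega => w i j omega ^+ 2)%R] = 1)%E.
Hypothesis w_moment : forall i j, (1 <= i)%N -> (1 <= j)%N ->
  ('E_Pw[(fun omega => `|w i j omega| `^ p)%R] <= K%:E)%E.

Lemma weight_moment8 (C : R) i j : 0 <= C -> (1 <= i)%N -> (1 <= j)%N ->
  Pw.-integrable setT (EFin \o (fun x => (C * (1 + `|w i j x|)) ^+ 8)) /\
  \int[Pw]_x ((C * (1 + `|w i j x|)) ^+ 8) <= (2 * C) ^+ 8 * (1 + K).
Proof.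
move=> C0 i1 j1; have mw : measurable_fun setT (w i j) := measurable_funP (w i j).
have mn : measurable_fun setT (fun x => `|w i j x|).
  by apply: measurableT_comp => //; exact: measurable_normr.
have ip : Pw.-integrable setT (EFin \o (fun x => `|w i j x| `^ p)).
  apply: (@ge0_integrable_EFin _ _ _ _ _ K).
  - exact: (measurableT_comp (measurable_powR p) mn).
  - by move=> x; exact: powR_ge0.
  - by have := w_moment i1 j1; rewrite unlock.
have i1p : Pw.-integrable setT (EFin \o (fun x => 1 + `|w i j x| `^ p)).
  by apply: integrable_EFinD => //; exact: integrable_EFin_cst.
have ib := integrable_EFinZ ((2 * C) ^+ 8) i1p.
have i8 : Pw.-integrable setT (EFin \o (fun x => (C * (1 + `|w i j x|)) ^+ 8)).
  apply: le_integrable_EFin ib.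
    by apply: measurable_funX; apply: measurable_funM => //; apply: measurable_funD.
  move=> x; rewrite ger0_norm ?exprn_ge0 ?mulr_ge0 ?addr_ge0//.
  exact: pow8_le_powR.
split => //; apply: (le_trans (RintegralT_le i8 ib _)).
  by move=> x; exact: pow8_le_powR.
rewrite RintegralZl//; apply: ler_wpM2l; first by rewrite exprn_ge0// mulr_ge0.
rewrite RintegralD//; last exact: integrable_EFin_cst.
rewrite Rintegral_probability_cst lerD2l -lee_fin EFin_Rintegral//.
by have := w_moment i1 j1; rewrite unlock.
Qed.

Lemma lattice_moment8 (C c : R) (f f1 f2 : R -> R) M N :
  1 <= C -> taylor_class C f f1 f2 -> (forall x, 0 <= f x) ->
  0 < c <= 1 -> c * (M + N)%:R <= M%:R -> c * (M + N)%:R <= N%:R ->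
  let A x := path_avg (lattice_walks M N)
    (fun s => f (rescaled_sum (fun i j => w i j x) M.+1 N.+1 s)) -
    \int[normal_prob 0 1]_y f y in
  measurable_fun setT A /\
  \int[Pw]_x (A x ^+ 8) <=
    (M + N).+1%:R^-1 ^+ 2 * expR ((2 * C) ^+ 8 * (1 + K) * (528 + 256 * (80 / c))).
Proof.
move=> C1 tf f0 c01 cM cN A.
have C0 : 0 <= C := le_trans ler01 C1.
have K0 : 0 <= 1 + K.
  rewrite addr_ge0// -lee_fin.
  apply: le_trans (w_moment (leqnn 1) (leqnn 1)); rewrite unlock.
  by apply: integral_ge0 => x _; rewrite lee_fin powR_ge0.
have L0 : 0 <= (2 * C) ^+ 8 * (1 + K) by rewrite mulr_ge0// exprn_ge0// mulr_ge0.
set n := (M + N).+1; set s := Num.sqrt (n%:R : R).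
have s1 : 1 <= s by rewrite -[leLHS](@sqrtr1 R) ler_wsqrtr// ler1n.
have s0 : 0 < s := lt_le_trans ltr01 s1.
have [r0 r1] : 0 < s^-1 /\ s^-1 <= 1 by rewrite invr_gt0 invf_le1.
have rq : Num.sqrt s^-1 ^+ 2 = s^-1 by rewrite sqr_sqrtr// ltW.
have q0 : 0 < Num.sqrt s^-1 by rewrite sqrtr_gt0.
have q1 : Num.sqrt s^-1 <= 1 by rewrite -[leRHS](@sqrtr1 R) ler_wsqrtr.
have r2 : s^-1 ^+ 2 = n%:R^-1 by rewrite exprVn sqr_sqrtr.
have V0D v : v \in rectangle M N -> [set ij : nat * nat | (1 <= ij.1)%N /\ (1 <= ij.2)%N] v.
  by rewrite mem_rectangle => /andP[/andP[? _] /andP[? _]].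
have AE x : A x = path_avg (lattice_walks M N)
    (fun t => f (s^-1 * \sum_(v <- t) w v.1 v.2 x)) - \int[normal_prob 0 1]_y f y.
  by rewrite /A /rescaled_sum addSn addnS subn1.
have [] := @lindeberg_moment8 _ Omega R Pw _ _ _ w_indep (lattice_walks M N) (rectangle M N) n
  isT (lattice_walks_neq0 M N) (rectangle_uniq M N) V0D (@lattice_walks_spec M N)
  C _ f f1 f2 C1 L0 tf f0 _ _ _ _ s^-1 (Num.sqrt s^-1) r0 q0 rq r1 q1 r2 (80 / c).
- by move=> [i j] [i1 j1]; have := w_mean i1 j1; rewrite /Rintegral unlock => ->.
- by move=> [i j] [i1 j1]; have := w_var i1 j1; rewrite /Rintegral unlock => ->.
- by move=> [i j] [i1 j1]; have [] := weight_moment8 C0 i1 j1.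
- by move=> [i j] [i1 j1]; have [] := weight_moment8 C0 i1 j1.
- by rewrite invrK; exact: sum_hit_prob_sq.
move=> mA hA; split.
  by rewrite (funext AE); apply: measurable_funB => //; exact: measurable_cst.
by under eq_Rintegral do rewrite AE.
Qed.

Lemma spline_family_ae_cvg (j : nat) (k : int) :
  {ae Pw, forall omega,
    \int[distribution (uniform_on R (up_right_paths (truncn (xi * N%:R)) N))
      (rescaled_sum (fun i j => w i j omega) (truncn (xi * N%:R)) N)]_x spline_family j k x
      @[N --> \oo] --> \int[normal_prob (0 : R) 1]_x spline_family j k x}.
Proof.
set f : R -> R := spline_family j k; set g := \int[normal_prob 0 1]_x f x.
pose C : R := 8 * j.+1%:R ^+ 3.
have j1 : 1 <= j.+1%:R :> R by rewrite ler1n.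
have C1 : 1 <= C by rewrite (@le_trans _ _ 8) ?ler1n// ler_peMr// exprn_ege1.
have tf := taylor_class_affine k%:~R j1 (@spline_taylor_class R).
have f0 x : 0 <= f x by have /andP[] := spline_ge0_le1 (j.+1%:R * x - k%:~R).
(* The limiting shares of the two kinds of steps are xi / (xi + 1) and 1 / (xi + 1). Their product
   lies below both; the factor 2 absorbs the rounding. *)
pose c := xi / (2 * (xi + 1) ^+ 2).
have x1 : 0 < xi + 1 by rewrite addr_gt0.
have /andP[c0 c1] : 0 < c <= 1.
  rewrite divr_gt0 ?mulr_gt0 ?exprn_gt0//= ler_pdivrMr ?mulr_gt0 ?exprn_gt0// mul1r.
  by nra.
(* From N0 on, xi N is at least 4, so the number of right steps, which exceeds xi N - 2, is at least
   half of xi N. *)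
pose N0 := (truncn (4 / xi)).+2.
have big N : (N0 <= N)%N -> exists m n,
    [/\ truncn (xi * N%:R) = m.+1, N = n.+1, c * (m + n)%:R <= m%:R & c * (m + n)%:R <= n%:R].
  move=> N0N; have N2 : (2 <= N)%N by apply: leq_trans N0N.
  have xN : 4 <= xi * N%:R.
    rewrite mulrC -ler_pdivrMr//; apply/ltW.
    apply: lt_le_trans (_ : (truncn (4 / xi)).+1%:R <= _); last by rewrite ler_nat ltnW.
    by have /andP[] := truncn_itv (divr_ge0 (ler0n R 4) (ltW xi_gt0)).
  have /andP[Mle Mgt] := truncn_itv (le_trans (ler0n R 4) xN).
  move: Mle Mgt; case EM: (truncn (xi * N%:R)) => [|m] Mle Mgt.
    by exfalso; move: (le_lt_trans xN Mgt); rewrite ltrn1.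
  case: N N2 xN Mle Mgt {EM N0N} => // n N2 xN Mle Mgt; exists m, n.
    suff [] : c * (m + n)%:R <= m%:R /\ c * (m + n)%:R <= n%:R by split.
    rewrite -[n.+1%:R]natr1 in xN Mle Mgt; rewrite -!natr1 in Mle Mgt; rewrite natrD.
    have n1 : 1 <= n%:R :> R by rewrite ler1n.
    move: (m%:R : R) (n%:R : R) n1 xN Mle Mgt => x y y1 xN Mle Mgt.
    have cxy : c * (x + y) <= xi * (y + 1) / (2 * (xi + 1)).
      have -> : xi * (y + 1) / (2 * (xi + 1)) = c * ((xi + 1) * (y + 1)) by rewrite /c; field; lra.
      by rewrite ler_wpM2l//; lra.
    have z0 : 0 < 2 * (xi + 1) by lra.
    by split; apply: (le_trans cxy); rewrite ler_pdivrMr//; nra.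
pose A N x := path_avg (lattice_walks (truncn (xi * N%:R)).-1 N.-1)
  (fun s => f (rescaled_sum (fun i j => w i j x) (truncn (xi * N%:R)) N s)) - g.
have AE N : (N0 <= N)%N -> measurable_fun setT (A N) /\
    (\int[Pw]_x (A N x ^+ 8)%:E <=
      (expR ((2 * C) ^+ 8 * (1 + K) * (528 + 256 * (80 / c))) * N%:R^-1 ^+ 2)%:E)%E.
  move=> /big[m [n [Em En cm cn]]]; rewrite /A Em En.
  have [mA A8] := lattice_moment8 C1 tf f0 (introT andP (conj c0 c1)) cm cn.
  split; first exact: mA.
  rewrite -EFin_Rintegral; last first.
    apply: (@integrable_EFin_bounded _ _ _ _ _ ((1 + `|g|) ^+ 8)).
      by apply: measurable_funX; exact: mA.
    move=> x; rewrite normrX lerXn2r ?nnegrE ?addr_ge0//.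
    apply: le_trans (ler_normB _ _) _; rewrite lerD2r.
    apply: path_avg_bound; first exact: lattice_walks_neq0.
    by move=> s; exact: spline_family_bound.
  rewrite lee_fin (le_trans A8)// mulrC ler_wpM2l ?expR_ge0//.
  rewrite lerXn2r ?nnegrE ?invr_ge0// lef_pV2 ?posrE ?ltr0n// ler_nat.
  by rewrite ltnS leq_addl.
have cv : {ae Pw, forall x, A N x @[N --> \oo] --> (0 : R)}.
  apply: (@ae_cvg0_of_moment8 _ _ _ _ _
    (expR ((2 * C) ^+ 8 * (1 + K) * (528 + 256 * (80 / c)))) N0).
  - by move=> N /AE[].
  - by move=> N /AE[].
apply: filterS cv => x Ax.
have : (fun N => A N x + g) @ \oo --> (0 + g) by apply: cvgD => //; exact: cvg_cst.
rewrite add0r; apply: cvg_trans; apply: near_eq_cvg.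
exists N0 => // N /= /big[m [n [Em En _ _]]].
have mf : measurable_fun [set: R] f by exact: continuous_measurable_fun (@spline_family_cts _ _ _).
rewrite /A subrK Em En (Rintegral_distribution _ mf (spline_family_bound j k)).
by rewrite Rintegral_uniform_on.
Qed.

End environment.

Theorem theorem1p1 (R : realType) (xi p K : R)
  (xi_gt0 : 0 < xi) (p_gt12 : 12 < p) (K_gt0 : 0 < K)
  (d : measure_display) (Omega : measurableType d) (Pw : probability Omega R)
  (w : nat -> nat -> {RV Pw >-> R})
  (w_indep : mutually_independent [set ij | (1 <= ij.1)%N /\ (1 <= ij.2)%N]
               (fun ij : nat * nat => w ij.1 ij.2))
  (w_mean : forall i j, (1 <= i)%N -> (1 <= j)%N -> ('E_Pw[w i j] = 0)%E)
  (w_var : forall i j, (1 <= i)%N -> (1 <= j)%N ->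
     ('E_Pw[(fun omega => w i j omega ^+ 2)%R] = 1)%E)
  (w_moment : forall i j, (1 <= i)%N -> (1 <= j)%N ->
     ('E_Pw[(fun omega => `|w i j omega| `^ p)%R] <= K%:E)%E) :
  let M (N : nat) : nat := truncn (xi * N%:R) in
  {ae Pw, forall omega,
    cvg_in_distribution
      (P := fun N => uniform_on R (up_right_paths (M N) N))
      (fun N => rescaled_sum (fun i j => w i j omega) (M N) N)
      (normal_prob 0 1)}.
Proof.
move=> M.
have p8 : 8 <= p by rewrite ltW// (lt_trans _ p_gt12)// ltr_nat.
(* An enumeration of all dilations and translates, so that one null set serves the whole family;
   numbers that decode to nothing are sent to (0, 0). *)
pose code (m : nat) : nat * int := odflt (0%N, 0) (choice.unpickle m).
have := ae_foralln (fun m => spline_family_ae_cvg xi_gt0 p8 w_indep w_mean w_var w_moment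
  (code m).1 (code m).2).
apply: filterS => x h; apply: spline_weak_cvg => j i.
by have := h (choice.pickle (j, i)); rewrite /code choice.pickleK.
Qed.
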